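(* Let $F_1$ on $L^1(X)^n$ and $F_2$ on $L^1(Y)^n$ be admissible integral functionals associated to the normal integrands $f_1$ and $f_2$, i.e. $F_1=I_{f_1}$ and $F_2=I_{f_2}$. Assume that for all $x\in X$ and $y\in Y$ there exist points $s_1,s_2\in\mathbb{R}^n$ with strictly positive coordinates such that $f_1(x,s_1)<\infty$ and $f_2(y,s_2)<\infty$, and that $K$ takes positive values. Set $b^{(0)}=1$ and let $(a^{(\ell)},b^{(\ell)})$ be the scaling iterates $$a^{(\ell+1)}=\frac{\mathrm{prox}^{\mathrm{KL}}_{F_1/\epsilon}(\mathcal{K} b^{(\ell)})}{\mathcal{K} b^{(\ell)}},\qquad b^{(\ell+1)}=\frac{\mathrm{prox}^{\mathrm{KL}}_{F_2/\epsilon}(\mathcal{K}^{T} a^{(\ell+1)})}{\mathcal{K}^{T} a^{(\ell+1)}},\qquad \ell=0,1,2,\dots$$ Then, with initialization $v^{(0)}=0$, the iterates $$u^{(\ell+1)}=\operatorname*{argmax}_{u:X\to\mathbb{R}^n} -I_{f_1^*}(-u)-\epsilon\,\langle e^{u/\epsilon},\mathcal{K} e^{v^{(\ell)}/\epsilon}\rangle_X,\qquad v^{(\ell+1)}=\operatorname*{argmax}_{v:Y\to\mathbb{R}^n} -I_{f_2^*}(-v)-\epsilon\,\langle e^{v/\epsilon},\mathcal{K}^{T} e^{u^{(\ell+1)}/\epsilon}\rangle_Y$$ (maximization over measurable functions) are uniquely well-defined, and for all $\ell$ one has $(a^{(\ell)},b^{(\ell)})=(e^{u^{(\ell)}/\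epsilon},e^{v^{(\ell)}/\epsilon})$.
   Context: Setting: $(X,dx)$ and $(Y,dy)$ are probability spaces, $X\times Y$ carries the product measure $dx\,dy$, $n\ge 1$ is an integer, $\epsilon>0$, and $K=(K_k)_{k=1}^n\in L^\infty_+(X\times Y)^n$ (nonnegative, essentially bounded). Operators: for measurable $a:X\to[0,\infty)^n$, $b:Y\to[0,\infty)^n$ and $k=1,\dots,n$, $(\mathcal{K}b)_k(x)=\int_Y K_k(x,y)b_k(y)\,dy$ and $(\mathcal{K}^{T}a)_k(y)=\int_X K_k(x,y)a_k(x)\,dx$. Exponentials, logarithms, products and quotients of $\mathbb{R}^n$-valued functions are taken componentwise; $\langle r,s\rangle_X=\sum_{k}\int_X r_k s_k\,dx$, and similarly on $Y$. Normal integrands: $f:X\times\mathbb{R}^n\to\mathbb{R}\cup\{\infty\}$ is a normal integrand if its epigraphical mapping $x\mapsto \operatorname{epi} f(x,\cdot)$ is closed-valued and measurable. A convex integral functional is $F=I_f$, $I_f(s)=\int_X f(x,s(x))\,dx$, with $f$ a normal integrand and $f(x,\cdot)$ convex for all $x$. It is admissible if moreover for all $x$, $f(x,\cdot)$ takes nonnegative values and has domain contained in $[0,\infty)^n$, and there exists $s\in L^1(X)^n$ with $I_f(s)<\infty$. The same definitions apply on $Y$. $f^*$ denotes the convex conjugate of $f$ in its second variable. KL divergence and prox: for measurable $r,s:X\to\mathbb{R}^n$, $\mathrm{KL}(r|s)=\sum_{k}\int_X[\log(r_k/s_k)r_k-r_k+s_k]\,dx$ (with $0\log(0/0)=0$)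 if $r,s\ge0$ a.e. and ($s_k=0\Rightarrow r_k=0$) a.e., and $+\infty$ otherwise. $\mathrm{prox}^{\mathrm{KL}}_{F_1/\epsilon}(z)=\operatorname*{argmin}\{F_1(s)+\epsilon\,\mathrm{KL}(s|z): s:X\to\mathbb{R}^n \text{ measurable}\}$, and similarly for $F_2$ on $Y$. Indexing: $b^{(\ell)},v^{(\ell)}$ are defined for $\ell\ge0$ and $a^{(\ell)},u^{(\ell)}$ for $\ell\ge1$. *)

(* Defs.v *)
From HB Require Import structures.
From mathcomp Require Import all_boot all_order all_algebra.
From mathcomp Require Import all_classical all_reals all_analysis.

Set Implicit Arguments.
Unset Strict Implicit.
Unset Printing Implicit Defensive.

Import Order.TTheory GRing.Theory Num.Theory.
Import numFieldNormedType.Exports.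

Local Open Scope classical_set_scope.
Local Open Scope ring_scope.
Local Open Scope ereal_scope.

(* Points of R^n are row vectors 'rV[R]_n, with coordinates s 0 k. *)

Definition measurable_vec {d} {T : measurableType d} {R : realType} {n : nat}
    (s : T -> 'rV[R]_n) : Prop :=
  forall k, measurable_fun setT (fun x => s x 0%R k).

Definition L1_vec {d} {T : measurableType d} {R : realType} {n : nat}
    (mu : {measure set T -> \bar R}) (s : T -> 'rV[R]_n) : Prop :=
  forall k, (fun x => s x 0%R k) \in Lfun mu 1.

(* Integral with the convention of convex analysis oo - oo = oo: it is +oo as
   soon as the positive part is not integrable (the library integral would
   give -oo when the negative part is not integrable either). *)
Definition convex_integral {d} {T : measurableType d} {R : realType}
    (mu : {measure set T -> \bar R}) (g : T -> \bar R) : \bar R :=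
  if \int[mu]_x (g^\+ x) == +oo then +oo else \int[mu]_x g x.

Definition integral_functional {d} {T : measurableType d} {R : realType}
    {n : nat} (mu : {measure set T -> \bar R}) (f : T -> 'rV[R]_n -> \bar R)
    (s : T -> 'rV[R]_n) : \bar R :=
  convex_integral mu (fun x => f x (s x)).

Definition epigraph {R : realType} {n : nat} (g : 'rV[R]_n -> \bar R) :
    set ('rV[R]_n * R) :=
  [set p | g p.1 <= p.2%:E].

(* A set-valued map S is measurable when {x | S x meets O} is measurable for
   every open set O. *)
Definition normal_integrand {d} {T : measurableType d} {R : realType}
    {n : nat} (f : T -> 'rV[R]_n -> \bar R) : Prop :=
  [/\ forall x s, f x s != -oo,
      forall x, closed (epigraph (f x)) &
      forall O : set ('rV[R]_n * R), open O ->
        measurable [set x | epigraph (f x) `&` O !=set0] ].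

Definition convex_ereal {R : realType} {n : nat} (g : 'rV[R]_n -> \bar R) :
    Prop :=
  forall (s t : 'rV[R]_n) (c : R), (0 <= c <= 1)%R ->
    g (c *: s + (1 - c) *: t)%R <= c%:E * g s + (1 - c)%:E * g t.

Definition admissible {d} {T : measurableType d} {R : realType} {n : nat}
    (mu : {measure set T -> \bar R}) (f : T -> 'rV[R]_n -> \bar R) : Prop :=
  normal_integrand f /\ (forall x, convex_ereal (f x)) /\
  (forall x s, 0 <= f x s) /\
  (forall x s, f x s < +oo -> forall k, (0 <= s 0 k)%R) /\
  (exists s : T -> 'rV[R]_n,
     L1_vec mu s /\ integral_functional mu f s < +oo).

Definition conjugate {R : realType} {n : nat} (g : 'rV[R]_n -> \bar R)
    (p : 'rV[R]_n) : \bar R :=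
  ereal_sup [set (\sum_(k < n) p 0%R k * s 0%R k)%R%:E - g s
            | s in [set: 'rV[R]_n]].

(* As x / 0 = 0 and ln 0 = 0, the integrand equals s_k when r_k = 0, and in
   particular 0 when r_k = s_k = 0. *)
Definition KL {d} {T : measurableType d} {R : realType} {n : nat}
    (mu : {measure set T -> \bar R}) (r s : T -> 'rV[R]_n) : \bar R :=
  if `[< {ae mu, forall x, forall k, [/\ (0 <= r x 0 k)%R, (0 <= s x 0 k)%R &
                                         s x 0%R k = 0%R -> r x 0%R k = 0%R]} >]
  then \sum_(k < n) \int[mu]_x
         (ln (r x 0 k / s x 0 k) * r x 0 k - r x 0 k + s x 0 k)%R%:E
  else +oo.

(* As usual in variational analysis, the set of minimizers of a function that
   is identically +oo is empty, and so is the set of maximizers of a function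
   that is identically -oo. *)
Definition argmin {S : Type} {R : realType} (D : set S) (J : S -> \bar R) :
    set S :=
  [set s | [/\ D s, J s < +oo & forall t, D t -> J s <= J t]].

Definition argmax {S : Type} {R : realType} (D : set S) (J : S -> \bar R) :
    set S :=
  [set s | [/\ D s, -oo < J s & forall t, D t -> J t <= J s]].

(* The set of representatives of the KL-proximal point at z of the functional
   I_f / eps. *)
Definition proxKL {d} {T : measurableType d} {R : realType} {n : nat}
    (mu : {measure set T -> \bar R}) (eps : R) (f : T -> 'rV[R]_n -> \bar R)
    (z : T -> 'rV[R]_n) : set (T -> 'rV[R]_n) :=
  argmin measurable_vec
    (fun s => integral_functional mu f s + eps%:E * KL mu s z).

Definition kernel_op {d1 d2} {X : measurableType d1} {Y : measurableType d2}
    {R : realType} {n : nat} (Q : {measure set Y -> \bar R})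
    (K : 'I_n -> X * Y -> R) (b : Y -> 'rV[R]_n) (k : 'I_n) (x : X) : \bar R :=
  \int[Q]_y (K k (x, y) * b y 0 k)%R%:E.

Definition kernel_tr {X Y : Type} {R : realType} {n : nat}
    (K : 'I_n -> X * Y -> R) : 'I_n -> Y * X -> R :=
  fun k p => K k (p.2, p.1).

(* a = prox(K b) / (K b) almost everywhere, where K b is required to be (a.e.)
   the R^n-valued function z. *)
Definition scaling_step {d1 d2} {X : measurableType d1}
    {Y : measurableType d2} {R : realType} {n : nat}
    (P : {measure set X -> \bar R}) (Q : {measure set Y -> \bar R})
    (eps : R) (f : X -> 'rV[R]_n -> \bar R) (K : 'I_n -> X * Y -> R)
    (b : Y -> 'rV[R]_n) (a : X -> 'rV[R]_n) : Prop :=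
  measurable_vec a /\
  exists z s : X -> 'rV[R]_n,
    [/\ measurable_vec z,
        {ae P, forall x, forall k, (z x 0%R k)%:E = kernel_op Q K b k x},
        proxKL P eps f z s &
        {ae P, forall x, forall k, a x 0%R k = (s x 0 k / z x 0 k)%R}].

Definition scaling_iterates {d1 d2} {X : measurableType d1}
    {Y : measurableType d2} {R : realType} {n : nat}
    (P : {measure set X -> \bar R}) (Q : {measure set Y -> \bar R})
    (eps : R) (f1 : X -> 'rV[R]_n -> \bar R) (f2 : Y -> 'rV[R]_n -> \bar R)
    (K : 'I_n -> X * Y -> R)
    (a : nat -> X -> 'rV[R]_n) (b : nat -> Y -> 'rV[R]_n) : Prop :=
  b 0%N = cst (const_mx 1%R) /\
  forall l, scaling_step P Q eps f1 K (b l) (a l.+1) /\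
            scaling_step Q P eps f2 (kernel_tr K) (a l.+1) (b l.+1).

Definition exp_vec {T : Type} {R : realType} {n : nat} (eps : R)
    (u : T -> 'rV[R]_n) : T -> 'rV[R]_n :=
  fun x => (\row_k expR (u x 0 k / eps))%R.

(* - I_{f^*}(- u) - eps <e^{u/eps}, K e^{v/eps}>; the ambiguous oo - oo is -oo,
   as it should be for a concave functional. *)
Definition dual_objective {d1 d2} {X : measurableType d1}
    {Y : measurableType d2} {R : realType} {n : nat}
    (P : {measure set X -> \bar R}) (Q : {measure set Y -> \bar R})
    (eps : R) (f : X -> 'rV[R]_n -> \bar R) (K : 'I_n -> X * Y -> R)
    (v : Y -> 'rV[R]_n) (u : X -> 'rV[R]_n) : \bar R :=
  - integral_functional P (fun x => conjugate (f x)) (fun x => - u x)%R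
  - eps%:E * \sum_(k < n) \int[P]_x
      ((exp_vec eps u x 0%R k)%:E * kernel_op Q K (exp_vec eps v) k x).

Definition dual_argmax {d1 d2} {X : measurableType d1}
    {Y : measurableType d2} {R : realType} {n : nat}
    (P : {measure set X -> \bar R}) (Q : {measure set Y -> \bar R})
    (eps : R) (f : X -> 'rV[R]_n -> \bar R) (K : 'I_n -> X * Y -> R)
    (v : Y -> 'rV[R]_n) : set (X -> 'rV[R]_n) :=
  argmax measurable_vec (dual_objective P Q eps f K v).

Definition dual_iterates {d1 d2} {X : measurableType d1}
    {Y : measurableType d2} {R : realType} {n : nat}
    (P : {measure set X -> \bar R}) (Q : {measure set Y -> \bar R})
    (eps : R) (f1 : X -> 'rV[R]_n -> \bar R) (f2 : Y -> 'rV[R]_n -> \bar R)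
    (K : 'I_n -> X * Y -> R)
    (u : nat -> X -> 'rV[R]_n) (v : nat -> Y -> 'rV[R]_n) : Prop :=
  v 0%N = cst 0%R /\
  forall l, dual_argmax P Q eps f1 K (v l) (u l.+1) /\
            dual_argmax Q P eps f2 (kernel_tr K) (u l.+1) (v l.+1).

(* Main.v *)
(* Idea. Minimizing the integral [F s + eps KL (s | z)] amounts to minimizing
   [f x t + eps kl (t | z x)] for almost every [x].  The pointwise minimizer [m]
   exists by compactness and is measurable, because for a normal integrand the
   infima of such functions over open half-spaces are measurable in [x].  It has
   positive coordinates, as the slope of [kl (. | z)] at [0] is [-oo], and
   [- u := - eps ln (m / z)] is a subgradient of [f x] at [m].  The three-point
   identity of [kl] yields, for every [u'],
     eps (sum z + kl (m | z e^(u'/eps)))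
       <= (f x)^* (- u') + eps sum (z e^(u'/eps)) + f x m + eps kl (m | z),
   with equality at [u' = u].  Integrated, this shows that [u] is the unique
   maximizer of the dual objective provided that [z] is integrable, and the same
   inequality gives the integrability of [z] as soon as some function has a
   finite dual value.  The preceding iterate is such a function: by Tonelli,
     <e^(u/eps), K e^(v/eps)>_X = <e^(v/eps), K^T e^(u/eps)>_Y,
   so that dual feasibility passes from each half-step to the next one. *)

Require Import Defs.
From HB Require Import structures.
From mathcomp Require Import all_boot all_order all_algebra.
From mathcomp Require Import all_classical all_reals all_analysis.
From mathcomp Require Import measurable_realfun.
From mathcomp Require Import ring lra.

Set Implicit Arguments.
Unset Strict Implicit.
Unset Printing Implicit Defensive.

Import Order.TTheory GRing.Theory Num.Theory.
Import numFieldNormedType.Exports.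

Local Open Scope classical_set_scope.
Local Open Scope ring_scope.

(** * The scalar Kullback-Leibler divergence *)

Section kl_scalar.
Context {R : realType}.
Implicit Types t m z u : R.

Lemma ln_le_sub1 t : 0 < t -> ln t <= t - 1.
Proof. by move=> t0; have := expR_ge1Dx (ln t); rewrite lnK ?posrE//; lra. Qed.

(** Since [ln] is 0 on nonpositive reals, for [0 < z] this is [z] at [t = 0] and [z - t] for
    [t < 0]; nonnegativity thus holds for every real [t]. *)
Definition kl t z : R := ln (t / z) * t - t + z.

Lemma kl_le0 t z : 0 < z -> t <= 0 -> kl t z = z - t.
Proof.
move=> z0 t0; rewrite /kl ln0; first by ring.
by rewrite pmulr_lle0 ?invr_gt0.
Qed.

(** For positive [t], the strict inequality [1 + h < expR h] at [h = - ln (t / z)], multiplied by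
    [t]. *)
Lemma kl_gt0 t z : 0 < z -> t != z -> 0 < kl t z.
Proof.
move=> z0 tz; have [t0|t0] := leP t 0; first by rewrite kl_le0//; lra.
have tz0 : 0 < t / z by rewrite divr_gt0.
have ln_neq0 : - ln (t / z) != 0.
  rewrite oppr_eq0 ln_eq0//; apply: contra tz => /eqP tz1.
  by rewrite -(divfK (lt0r_neq0 z0) t) tz1 mul1r.
have := expR_gt1Dx ln_neq0; rewrite expRN lnK ?posrE// invf_div ltr_pdivlMr//.
by rewrite /kl; lra.
Qed.

Lemma kl_ge0 t z : 0 < z -> 0 <= kl t z.
Proof.
move=> z0; have [->|tz] := eqVneq t z; last exact/ltW/kl_gt0.
by rewrite /kl divff ?lt0r_neq0// ln1; lra.
Qed.

Lemma kl_eq0 t z : 0 < z -> kl t z = 0 -> t = z.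
Proof.
move=> z0; have [->//|tz kl0] := eqVneq t z.
by have := kl_gt0 z0 tz; rewrite kl0 ltxx.
Qed.

(** Bregman identity: the slope of [kl (. | z)] at [m] is [ln (m / z)], and the remainder of the
    first-order expansion is again a divergence. *)
Lemma kl_three_points t m z : 0 <= t -> 0 < m -> 0 < z ->
  kl t z = kl m z + ln (m / z) * (t - m) + kl t m.
Proof.
rewrite le_eqVlt => /predU1P[<- m0 z0|t0 m0 z0].
  by rewrite !(kl_le0 (t:=0))// /kl; ring.
rewrite /kl !ln_div ?posrE//; ring.
Qed.

(** Tangent line of slope 1, taken at [expR 1 * z]. This coercivity bounds the sublevel sets, and
    later the mass of the minimizer. *)
Lemma ler_kl t z : 0 <= t -> 0 < z -> t <= kl t z + expR 1 * z.
Proof.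
move=> t0 z0; have ez : 0 < expR 1 * z by rewrite mulr_gt0 ?expR_gt0.
rewrite (kl_three_points t0 ez z0) mulfK ?lt0r_neq0// expRK.
have := kl_ge0 t ez; rewrite {2}/kl mulfK ?lt0r_neq0// expRK; lra.
Qed.

Lemma continuous_xlnx : continuous (fun t : R => t * ln t).
Proof.
move=> t; have [t0|t0|->] := ltgtP t 0.
- have near_lt0 : \forall s \near t, s < 0.
    by apply: open_nbhs_nbhs; split => //; exact: open_lt.
  rewrite /continuous_at /= (ln0 (ltW t0)) mulr0; apply: cvg_near_cst.
  by apply: filterS near_lt0 => s s0; rewrite ln0 ?mulr0// ltW.
- by apply: cvgM; [exact: cvg_id|exact: continuous_ln].
rewrite /continuous_at mul0r; apply/cvgrPdist_le => e e0.
(* With [y = Num.sqrt s], the absolute value of [s * ln s] is [2 y] times [- y * ln y], and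
   [- ln y <= y^-1] bounds it by [2 y]; hence the threshold [(e / 2) ^+ 2]. The bound 1 fixes the
   sign of [ln s]. *)
have d0 : 0 < Num.min 1 ((e / 2) ^+ 2).
  by rewrite lt_min ltr01 exprn_gt0// divr_gt0.
have near_d : \forall s \near (0 : R), s < Num.min 1 ((e / 2) ^+ 2).
  by apply: open_nbhs_nbhs; split => //; exact: open_lt.
near=> s.
have [s0|s0] := leP s 0; first by rewrite ln0// mulr0 subr0 normr0 ltW.
have : s < Num.min 1 ((e / 2) ^+ 2).
  by near: s; exact: near_d.
rewrite lt_min => /andP[s1 se].
have y0 : 0 < Num.sqrt s by rewrite sqrtr_gt0.
have sE : s = Num.sqrt s ^+ 2 by rewrite sqr_sqrtr// ltW.
have ye : Num.sqrt s <= e / 2.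
  by rewrite -(@ler_pXn2r _ 2) ?nnegrE ?sqrtr_ge0 ?divr_ge0 ?ltW// -sE.
have ln_le : - ln (Num.sqrt s) <= (Num.sqrt s)^-1.
  rewrite -lnV ?posrE//; apply/ltW/ln_sublinear.
  by rewrite invr_gt0.
rewrite sub0r normrN ler0_norm; last first.
  by rewrite pmulr_rle0// ln_le0// ltW.
rewrite {2}sE lnXn// {1}sE.
move: ln_le; rewrite -(ler_pM2l y0) divff ?lt0r_neq0//.
set y := Num.sqrt s in y0 ye *; move=> h.
rewrite mulr2n; nra.
Unshelve. all: by end_near. Qed.

End kl_scalar.

(** * Pointwise proximal points and duality *)

Section proximal_point.
Context {R : realType} {n : nat}.
Variables (eps : R) (g : 'rV[R]_n -> \bar R) (z : 'rV[R]_n).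
Hypothesis eps0 : 0 < eps.
Hypothesis g_convex : convex_ereal g.
Hypothesis g_ge0 : forall t, (0 <= g t)%E.
Hypothesis g_dom : forall t, (g t < +oo)%E -> forall k, 0 <= t 0 k.
Hypothesis g_pos : exists t : 'rV[R]_n, (forall k, 0 < t 0 k) /\ (g t < +oo)%E.
Hypothesis z_gt0 : forall k, 0 < z 0 k.

Definition klv (t s : 'rV[R]_n) : R := \sum_(k < n) kl (t 0 k) (s 0 k).

Lemma klv_ge0 (t s : 'rV[R]_n) : (forall k, 0 < s 0 k) -> 0 <= klv t s.
Proof. by move=> s0; apply: sumr_ge0 => k _; exact: kl_ge0. Qed.

Definition prox_point (m : 'rV[R]_n) : Prop :=
  (g m < +oo)%E /\
  forall t, (g m + (eps * klv m z)%:E <= g t + (eps * klv t z)%:E)%E.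

Let g_fin t : (g t < +oo)%E -> g t = (fine (g t))%:E.
Proof. by move=> gt; rewrite fineK// ge0_fin_numE. Qed.

Section minimizer.
Variable m : 'rV[R]_n.
Hypothesis m_prox : prox_point m.

Let m_ge0 k : 0 <= m 0 k.
Proof. by case: m_prox => + _ => /g_dom. Qed.

(** Minimality of [m] against a point of the segment from [m] to [t]: convexity bounds [g] there,
    the three-point identity based at that point bounds the divergence, and a factor [th]
    cancels. *)
Lemma prox_point_slope t (th : R) : (g t < +oo)%E -> 0 < th < 1 ->
  (forall k, 0 < th * t 0 k + (1 - th) * m 0 k) ->
  fine (g m) - fine (g t) <=
  eps * \sum_(k < n)
    ln ((th * t 0 k + (1 - th) * m 0 k) / z 0 k) * (t 0 k - m 0 k).
Proof.
move=> gt /andP[th0 th1] mt_gt0.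
have [gm m_min] := m_prox.
set mt := th *: t + (1 - th) *: m.
have mtE k : mt 0 k = th * t 0 k + (1 - th) * m 0 k by rewrite !mxE.
have gmt_le : (g mt <= (th * fine (g t) + (1 - th) * fine (g m))%:E)%E.
  have := g_convex t m (c := th).
  rewrite (ltW th0) (ltW th1) => /(_ isT) /le_trans; apply.
  by rewrite (g_fin gt) (g_fin gm) -!EFinM -EFinD.
have gmt : (g mt < +oo)%E by exact: le_lt_trans gmt_le (ltry _).
have := m_min mt; move: gmt_le.
rewrite (g_fin gmt) (g_fin gm) (g_fin gt) /= -!EFinD !lee_fin => gmt_le min_mt.
have klv_le : klv m z - klv mt z >= - th * \sum_(k < n)
    ln ((th * t 0 k + (1 - th) * m 0 k) / z 0 k) * (t 0 k - m 0 k).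
  rewrite /klv -sumrB mulr_sumr; apply: ler_sum => k _.
  have mt0 : 0 < mt 0 k by rewrite mtE.
  rewrite (kl_three_points (m_ge0 k) mt0 (z_gt0 k)) mtE.
  have := kl_ge0 (m 0 k) mt0; rewrite mtE.
  set l := ln _; set h := kl (m 0 k) _; set a := kl _ (z 0 k); nra.
move: klv_le; rewrite -(ler_pM2l eps0); set S := \sum_(_ < _) _ => klv_le.
rewrite -(ler_pM2l th0); nra.
Qed.

(** If [m 0 k] were 0, moving towards a positive point of the domain would give a slope containing
    [ln th * t 0 k], which tends to [-oo] with [th] while all other terms stay bounded above. *)
Lemma prox_point_gt0 k : 0 < m 0 k.
Proof.
have [t [t0 gt]] := g_pos.
rewrite lt_neqAle m_ge0 andbT; apply/eqP => /esym mk0.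
have slope th : 0 < th < 1 -> fine (g m) - fine (g t) <=
    eps * (\sum_(j < n | j != k) ln (t 0 j / z 0 j) * (t 0 j - m 0 j) +
           (ln th + ln (t 0 k / z 0 k)) * t 0 k).
  move=> th01; have /andP[th0 th1] := th01.
  have mt0 j : 0 < th * t 0 j + (1 - th) * m 0 j.
    by rewrite ltr_pwDl ?mulr_gt0// mulr_ge0// subr_ge0 ltW.
  apply: le_trans (prox_point_slope gt th01 mt0) _.
  rewrite ler_pM2l// (bigD1 k)//= addrC lerD//.
    (* The moving point lies between [m 0 j] and [t 0 j], so replacing it by [t 0 j] increases the
       term whatever the sign of [t 0 j - m 0 j]. *)
    apply: ler_sum => j _; have [mt|tm] := leP (m 0 j) (t 0 j).
      rewrite ler_wpM2r ?subr_ge0// ler_ln ?posrE ?divr_gt0//.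
      by rewrite ler_pM2r ?invr_gt0//; nra.
    rewrite ler_wnM2r ?subr_le0 ?(ltW tm)// ler_ln ?posrE ?divr_gt0//.
    by rewrite ler_pM2r ?invr_gt0//; nra.
  by rewrite mk0 mulr0 addr0 subr0 -mulrA lnM ?posrE ?divr_gt0.
set S := \sum_(j < n | _) _ in slope.
(* The slope inequality now reads [c <= ln th * t 0 k]. The choice of [ln th] below violates it, and
   its bound by -1 keeps [th < 1]. *)
pose c := (fine (g m) - fine (g t)) / eps - S - ln (t 0 k / z 0 k) * t 0 k.
have : c <= (Num.min (- 1) (c / t 0 k - 1)) * t 0 k.
  have := slope (expR (Num.min (- 1) (c / t 0 k - 1))).
  rewrite expR_gt0 expR_lt1 gt_min oppr_lt0 ltr01 => /(_ isT).
  rewrite expRK -ler_pdivrMl//.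
  rewrite /c; set q := Num.min _ _; rewrite mulrC; lra.
rewrite leNgt => /negP; apply.
have : Num.min (- 1) (c / t 0 k - 1) <= c / t 0 k - 1.
  by rewrite ge_min lexx orbT.
rewrite -(ler_pM2r (t0 k)) => /le_lt_trans; apply.
by rewrite mulrBl divfK ?lt0r_neq0// mul1r ltrBlDr ltrDl.
Qed.

Lemma prox_point_subgradient t : (g t < +oo)%E ->
  fine (g m) - fine (g t) <=
  eps * \sum_(k < n) ln (m 0 k / z 0 k) * (t 0 k - m 0 k).
Proof.
move=> gt; have m0 := prox_point_gt0.
(* Replacing the logarithms at the moving point by those at [m] costs at most [2 * th * C], because
   [th <= 2^-1] keeps the moving point above [m / 2]. Then [th] tends to 0. *)
pose C := \sum_(k < n) (t 0 k - m 0 k) ^+ 2 / m 0 k.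
have C0 : 0 <= C by apply: sumr_ge0 => k _; rewrite divr_ge0 ?sqr_ge0.
suff slope th : 0 < th <= 2^-1 -> fine (g m) - fine (g t) <=
    eps * \sum_(k < n) ln (m 0 k / z 0 k) * (t 0 k - m 0 k) +
    th * (2 * eps * C).
  apply/ler_addgt0Pl => e e0.
  pose D := 2 * eps * C + 1.
  have D0 : 0 < D by rewrite ltr_wpDl// mulr_ge0// mulr_ge0// ltW.
  have := slope (Num.min 2^-1 (e / D)).
  rewrite lt_min invr_gt0 ltr0n divr_gt0//= ge_min lexx => /(_ isT).
  move=> /le_trans; apply; rewrite addrC lerD2r.
  apply: (@le_trans _ _ (e / D * (2 * eps * C))).
    by rewrite ler_wpM2r ?mulr_ge0 ?(ltW eps0)// ge_min lexx orbT.
  rewrite mulrAC ler_pdivrMr// ler_pM2l//.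
  by rewrite /D lerDl.
move=> /andP[th0 th2].
have th01 : 0 < th < 1 by rewrite th0/=; lra.
have t0 := g_dom gt.
have mt0 k : 0 < th * t 0 k + (1 - th) * m 0 k.
  by rewrite ltr_wpDl ?mulr_gt0 ?mulr_ge0 ?(ltW th0)//; lra.
apply: le_trans (prox_point_slope gt th01 mt0) _.
rewrite [th * _]mulrC -!mulrA mulrCA -mulrDr ler_pM2l// [2 * _]mulrC -mulrA.
rewrite mulr_suml.
rewrite -big_split/=; apply: ler_sum => k _.
move: (m0 k) (mt0 k) (t0 k) (z_gt0 k).
set a := m 0 k; set b := t 0 k; set w := z 0 k => a0 c0 b0 w0.
set c := th * b + (1 - th) * a in c0 *.
have -> : ln (c / w) = ln (a / w) + ln (c / a) by rewrite !ln_div//; ring.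
rewrite mulrDl lerD2l.
have [ab|ba] := leP a b.
  apply: (@le_trans _ _ ((c / a - 1) * (b - a))).
    by rewrite ler_wpM2r ?subr_ge0// ln_le_sub1// divr_gt0.
  have -> : (c / a - 1) * (b - a) = th * ((b - a) ^+ 2 / a).
    by rewrite /c; field; rewrite lt0r_neq0.
  have := divr_ge0 (sqr_ge0 (b - a)) (ltW a0).
  set q := _ / _ => q0; nra.
have -> : ln (c / a) * (b - a) = ln (a / c) * (a - b).
  by rewrite !ln_div//; ring.
apply: (@le_trans _ _ ((a / c - 1) * (a - b))).
  by rewrite ler_wpM2r ?subr_ge0 ?(ltW ba)// ln_le_sub1// divr_gt0.
have -> : (a / c - 1) * (a - b) = th * ((b - a) ^+ 2 / c).
  by rewrite /c; field; rewrite lt0r_neq0.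
have : (b - a) ^+ 2 / c <= 2 * ((b - a) ^+ 2 / a).
  have ac : a <= 2 * c.
    have : 0 <= th * b by rewrite mulr_ge0// ltW.
    by rewrite /c; nra.
  rewrite ler_pdivrMr// [leRHS]mulrAC mulrA ler_pdivlMr// [leRHS]mulrC.
  by rewrite ler_wpM2l ?sqr_ge0.
set q := _ / _; set q' := _ / _; nra.
Qed.

(** The subgradient inequality and the three-point identity sharpen minimality by the divergence
    from [m]; uniqueness and measurability of the minimizer rest on this extra term. *)
Lemma prox_point_growth t :
  (g m + (eps * (klv m z + klv t m))%:E <= g t + (eps * klv t z)%:E)%E.
Proof.
have [gt|] := ltP (g t) +oo%E; last by rewrite leye_eq => /eqP ->; rewrite leey.
have [gm _] := m_prox; have t0 := g_dom gt.
rewrite (g_fin gm) (g_fin gt) -!EFinD lee_fin.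
have -> : klv t z = klv m z + klv t m +
    \sum_(k < n) ln (m 0 k / z 0 k) * (t 0 k - m 0 k).
  rewrite /klv -!big_split/=; apply: eq_bigr => k _.
  by rewrite (kl_three_points (t0 k) (prox_point_gt0 k) (z_gt0 k)); ring.
have := prox_point_subgradient gt; nra.
Qed.

(** The optimality condition solved for the dual variable: [- prox_dual] is a subgradient of [g] at
    [m]. *)
Definition prox_dual : 'rV[R]_n := \row_k (eps * ln (m 0 k / z 0 k)).

Lemma expR_prox_dual k : z 0 k * expR (prox_dual 0 k / eps) = m 0 k.
Proof.
rewrite mxE mulrAC divff ?lt0r_neq0// mul1r.
rewrite lnK ?posrE ?divr_gt0 ?prox_point_gt0//.
by rewrite mulrC divfK// lt0r_neq0.
Qed.

Lemma conjugate_ge (p t : 'rV[R]_n) : (g t < +oo)%E ->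
  ((\sum_(k < n) p 0 k * t 0 k - fine (g t))%:E <= conjugate g p)%E.
Proof.
move=> gt; apply: ereal_sup_ubound; exists t => //.
by rewrite EFinB -(g_fin gt).
Qed.

Let dual_sum : \sum_(k < n) (- prox_dual) 0 k * m 0 k =
  eps * \sum_(k < n) z 0 k - eps * \sum_(k < n) m 0 k - eps * klv m z.
Proof.
rewrite /klv -!mulrBr -!sumrB mulr_sumr; apply: eq_bigr => k _.
by rewrite !mxE /kl; ring.
Qed.

(** Equality case of Fenchel-Young at [m], by the subgradient inequality. *)
Lemma conjugate_prox_dual : conjugate g (- prox_dual) =
  (eps * \sum_(k < n) z 0 k - eps * \sum_(k < n) m 0 k -
   (fine (g m) + eps * klv m z))%:E.
Proof.
have [gm _] := m_prox.
have -> : eps * \sum_(k < n) z 0 k - eps * \sum_(k < n) m 0 k -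
   (fine (g m) + eps * klv m z) =
   \sum_(k < n) (- prox_dual) 0 k * m 0 k - fine (g m).
  by rewrite dual_sum; ring.
apply/eqP; rewrite eq_le; apply/andP; split; last exact: conjugate_ge.
apply: ub_ereal_sup => _ [t _ <-].
have [gt|] := ltP (g t) +oo%E; last first.
  by rewrite leye_eq => /eqP ->; rewrite addeNy leNye.
rewrite (g_fin gt) -EFinB lee_fin.
have := prox_point_subgradient gt.
have -> : eps * \sum_(k < n) ln (m 0 k / z 0 k) * (t 0 k - m 0 k) =
    \sum_(k < n) (- prox_dual) 0 k * m 0 k -
    \sum_(k < n) (- prox_dual) 0 k * t 0 k.
  by rewrite -sumrB mulr_sumr; apply: eq_bigr => k _; rewrite !mxE; ring.
lra.
Qed.

(** Fenchel-Young at [m] for an arbitrary dual point [u]. The term [klv m w] is a lower bound for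
    the loss, and vanishes only if [w = m]. *)
Lemma prox_dual_gap (u w : 'rV[R]_n) :
  (forall k, w 0 k = z 0 k * expR (u 0 k / eps)) ->
  ((eps * (\sum_(k < n) z 0 k + klv m w))%:E <=
   conjugate g (- u) +
   (eps * \sum_(k < n) w 0 k + (fine (g m) + eps * klv m z))%:E)%E.
Proof.
move=> wE; have gm := m_prox.1.
apply: le_trans (leeD2r _ (conjugate_ge (- u) gm)).
rewrite -EFinD lee_fin.
have -> : \sum_(k < n) (- u) 0 k * m 0 k =
    \sum_(k < n) (- prox_dual) 0 k * m 0 k +
    eps * (klv m w - \sum_(k < n) w 0 k + \sum_(k < n) m 0 k).
  rewrite /klv -!sumrB -big_split/= mulr_sumr -big_split/=.
  apply: eq_bigr => k _; have m0 := prox_point_gt0 k; have z0 := z_gt0 k.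
  rewrite !mxE wE /kl.
  have -> : ln (m 0 k / (z 0 k * expR (u 0 k / eps))) =
      ln (m 0 k / z 0 k) - u 0 k / eps.
    rewrite !ln_div ?posrE ?mulr_gt0 ?expR_gt0// lnM ?posrE ?expR_gt0//.
    by rewrite expRK; ring.
  by field; rewrite lt0r_neq0.
by rewrite dual_sum; lra.
Qed.

End minimizer.
End proximal_point.

(** * Existence of pointwise proximal points *)

Section kl_continuity.
Context {R : realType}.

(* Agrees with [kl] for [0 <= t], and is jointly continuous where [0 < z]. *)
Definition klc (t z : R) : R := t * ln t - t * ln z - t + z.

Lemma klcE t z : 0 <= t -> 0 < z -> kl t z = klc t z.
Proof.
rewrite le_eqVlt /klc => /predU1P[<- z0|t0 z0].
  by rewrite (kl_le0 z0)//; ring.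
by rewrite /kl ln_div//; ring.
Qed.

Lemma continuous_klc (t z : R) : 0 < z ->
  klc tz.1 tz.2 @[tz --> (t, z)] --> klc t z.
Proof.
move=> z0; apply: cvgD; last exact: cvg_snd.
apply: cvgB; last exact: cvg_fst.
apply: cvgB.
  apply: (@cvg_comp _ _ _ fst (fun t : R => t * ln t) _ (nbhs t)).
    exact: cvg_fst.
  exact: continuous_xlnx.
apply: cvgM; first exact: cvg_fst.
apply: (@cvg_comp _ _ _ snd (@ln R) _ (nbhs z)).
  exact: cvg_snd.
exact: continuous_ln.
Qed.

End kl_continuity.

Section prox_existence.
Context {R : realType} {n : nat}.

Let add_cont : continuous (fun xy : R * R => xy.1 + xy.2).
Proof. exact: add_continuous. Qed.

(** The value of [g] is replaced by the epigraph variable [p.2]: a lower semicontinuous minimization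
    becomes that of a continuous function over a closed set. *)
Definition prox_energy (eps : R) (w : 'rV[R]_n) (p : 'rV[R]_n * R) : R :=
  p.2 + eps * \sum_(k < n) klc (p.1 0 k) (w 0 k).

Lemma prox_energyE (eps : R) (w : 'rV[R]_n) (p : 'rV[R]_n * R) :
  (forall k, 0 < w 0 k) -> (forall k, 0 <= p.1 0 k) ->
  prox_energy eps w p = p.2 + eps * klv p.1 w.
Proof.
move=> w0 p0; rewrite /prox_energy /klv; congr (_ + _ * _).
by apply: eq_bigr => k _; rewrite klcE.
Qed.

Lemma continuous_prox_energy (eps : R) (w : 'rV[R]_n) (p : 'rV[R]_n * R) :
  (forall k, 0 < w 0 k) ->
  prox_energy eps wp.1 wp.2 @[wp --> (w, p)] --> prox_energy eps w p.
Proof.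
move=> w0; apply: cvgD.
  apply: (@cvg_comp _ _ _ snd snd _ (nbhs p)); first exact: cvg_snd.
  by case: p => p1 p2; exact: cvg_snd.
apply: cvgM; first exact: cvg_cst.
apply: (@cvg_big R 'I_n +%R 0 predT) => // k _.
apply: (@continuous2_cvg _ _ _ _ (nbhs (w, p)) _ (fun wp => wp.2.1 0 k)
  (fun wp => wp.1 0 k) klc); first exact: continuous_klc.
  apply: (@cvg_comp _ _ _ (fun wp : 'rV[R]_n * ('rV[R]_n * R) => wp.2.1)
    (fun t : 'rV[R]_n => t 0 k) _ (nbhs p.1)); last exact: coord_continuous.
  apply: (@cvg_comp _ _ _ snd fst _ (nbhs p)); first exact: cvg_snd.
  by case: p => p1 p2; exact: cvg_fst.
apply: (@cvg_comp _ _ _ fst (fun t : 'rV[R]_n => t 0 k) _ (nbhs w)).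
  exact: cvg_fst.
exact: coord_continuous.
Qed.

Lemma prox_point_exists (eps : R) (g : 'rV[R]_n -> \bar R) (z : 'rV[R]_n) :
  0 < eps -> closed (epigraph g) -> (forall t, (0 <= g t)%E) ->
  (forall t, (g t < +oo)%E -> forall k, 0 <= t 0 k) ->
  (exists t, (g t < +oo)%E) -> (forall k, 0 < z 0 k) ->
  exists m, prox_point eps g z m.
Proof.
move=> eps0 g_closed g_ge0 g_dom [t1 gt1] z0.
have g_fin t : (g t < +oo)%E -> g t = (fine (g t))%:E.
  by move=> gt; rewrite fineK// ge0_fin_numE.
(* Energy of the reference point [t1]. By [ler_kl], epigraph points of energy at most [c] lie in the
   compact box with sides [M k] and [c]. *)
pose c := fine (g t1) + eps * klv t1 z.
pose M k := c / eps + expR 1 * z 0 k.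
have in_box t a : (g t <= a%:E)%E -> a + eps * klv t z <= c ->
    (forall k, 0 <= t 0 k <= M k) /\ 0 <= a <= c.
  move=> gta tac; have gt := le_lt_trans gta (ltry a).
  have a0 : 0 <= a by rewrite -lee_fin (le_trans (g_ge0 t)).
  have t0 := g_dom _ gt.
  have H0 : 0 <= eps * klv t z by rewrite mulr_ge0 ?klv_ge0// ltW.
  split=> [k|]; last by apply/andP; split => //; lra.
  rewrite t0/= /M; apply: le_trans (ler_kl (t0 k) (z0 k)) _.
  rewrite lerD2r ler_pdivlMr// mulrC.
  apply: le_trans (_ : eps * klv t z <= _); last by lra.
  rewrite ler_pM2l// /klv (bigD1 k)//= lerDl.
  by apply: sumr_ge0 => j _; exact: kl_ge0.
pose B : set ('rV[R]_n * R) :=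
  [set t : 'rV[R]_n | forall k, `[0, M k]%classic (t 0 k)] `*` `[0, c]%classic.
have B_compact : compact B.
  apply: compact_setX; last exact: segment_compact.
  apply: (@rV_compact _ _ (fun k => `[0, M k]%classic)) => k.
  exact: segment_compact.
pose A := B `&` epigraph g.
have A_compact : compact A by exact: compact_closedI.
have A1 : A (t1, fine (g t1)).
  have gt1' : (g t1 <= (fine (g t1))%:E)%E by rewrite -g_fin.
  have [t1M a1c] := in_box _ _ gt1' (lexx _).
  by split => //; split => [k|] /=; rewrite in_itv/=.
have F_cont : {within A, continuous (prox_energy eps z)}.
  apply: continuous_subspaceT => p.
  apply: (@continuous2_cvg _ _ _ _ (nbhs p) _ (cst z) id (prox_energy eps)).
  - exact: continuous_prox_energy.
  - exact: cvg_cst.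
  - exact: cvg_id.
have [|[m a]] := compact_EVT_min _ A_compact F_cont.
  by exists (t1, fine (g t1)).
rewrite inE => -[[/= mM ac] gma] m_min.
have gm := le_lt_trans gma (ltry a).
exists m; split => // t.
have [gt|] := ltP (g t) +oo%E; last by rewrite leye_eq => /eqP ->; rewrite leey.
rewrite (g_fin _ gm) (g_fin _ gt) -!EFinD lee_fin.
have gm_le : fine (g m) <= a by rewrite -lee_fin -g_fin.
have EA p : A p -> a + eps * klv m z <= p.2 + eps * klv p.1 z.
  move=> Ap; have := m_min p; rewrite inE => /(_ Ap).
  rewrite !prox_energyE//= => k.
    by case: Ap => -[/(_ k)]/=; rewrite in_itv/= => /andP[].
  by have := mM k; rewrite in_itv/= => /andP[].
apply: le_trans (_ : a + eps * klv m z <= _); first by rewrite lerD2r.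
(* Competitors of energy above [c] are beaten by [t1], which belongs to [A]; the others belong to
   [A] themselves. *)
have [tc|/ltW ct] := leP (fine (g t) + eps * klv t z) c; last first.
  by apply: le_trans ct; exact: (EA _ A1).
apply: (EA (t, fine (g t))).
have gt' : (g t <= (fine (g t))%:E)%E by rewrite -g_fin.
have [tM ac'] := in_box _ _ gt' tc.
by split => //; split => [k|] /=; rewrite in_itv/=.
Qed.

End prox_existence.

(** * Measurability for normal integrands *)

Section hit_measurability.
Context {d} {X : measurableType d} {R : realType} {n : nat}.

Definition ratv (q : 'rV[rat]_n) : 'rV[R]_n := map_mx ratr q.

Lemma rat_approx (x e : R) : 0 < e -> exists q : rat, ball x e (ratr q).
Proof.
move=> e0; have : x - e < x + e by lra.
move=> /rat_in_itvoo[q]; rewrite in_itv/= => /andP[xq qx]; exists q.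
by rewrite /ball/= ltr_distlC xq qx.
Qed.

Lemma ratv_approx (x : 'rV[R]_n) (e : R) : 0 < e ->
  exists q, ball x e (ratv q).
Proof.
move=> e0; have /choice[q qP] k := rat_approx (x 0 k) e0.
exists (\row_k q k); split=> // i k; rewrite ord1 !mxE; exact: qP.
Qed.

Lemma measurable_preimage_ball (w : X -> 'rV[R]_n) (q : 'rV[R]_n) (e : R) :
  measurable_vec w -> 0 < e -> measurable [set x | ball q e (w x)].
Proof.
move=> mw e0.
rewrite (_ : mkset _ = \bigcap_(k in [set: 'I_n])
    (setT `&` (fun x => w x 0 k) @^-1` ball (q 0 k) e)).
  apply: fin_bigcap_measurable => // k _.
  by apply: (mw k) => //; exact: measurable_ball.
apply/seteqP; split=> [x [_ wx] k _|x wx]; first by split => //; exact: wx.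
split=> // i k; rewrite ord1; exact: (wx k I).2.
Qed.

(* Cover the open set [O] by countably many rational products of balls. *)
Lemma measurable_hit (S : X -> set ('rV[R]_n * R)) (w : X -> 'rV[R]_n)
    (O : set ('rV[R]_n * ('rV[R]_n * R))) :
  (forall U, open U -> measurable [set x | S x `&` U !=set0]) ->
  measurable_vec w -> open O ->
  measurable [set x | exists p, S x p /\ O (w x, p)].
Proof.
move=> mS mw oO.
pose wball (i : 'rV[rat]_n * ('rV[rat]_n * rat) * nat) : set 'rV[R]_n :=
  ball (ratv i.1.1) i.2.+1%:R^-1.
pose pball (i : 'rV[rat]_n * ('rV[rat]_n * rat) * nat) : set ('rV[R]_n * R) :=
  (ball (ratv i.1.2.1, ratr i.1.2.2 : R) i.2.+1%:R^-1)°.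
pose E i := if `[< wball i `*` pball i `<=` O >] then
  [set x | wball i (w x)] `&` [set x | S x `&` pball i !=set0] else set0.
rewrite (_ : mkset _ = \bigcup_i E i).
  apply: countable_bigcupT_measurable => // i; rewrite /E; case: ifP => // _.
  apply: measurableI; first exact: measurable_preimage_ball.
  by apply: mS; exact: open_interior.
apply/seteqP; split=> [x [p [Sp Op]]|x [i _]]; last first.
  rewrite /E; case: asboolP => // iO [wx [p [Sp pi]]]; exists p; split => //.
  exact: iO.
have /nbhs_ballP[e /= e0 eO] : nbhs (w x, p) O by apply: open_nbhs_nbhs.
have [N Ne] : exists N, N.+1%:R^-1 < e / 2.
  have e2 : 0 < e / 2 by rewrite divr_gt0.
  have [N _ /(_ N (leqnn N))] := near_infty_natSinv_lt (PosNum e2).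
  by exists N.
have [delta deltaE] : exists delta : R, delta = N.+1%:R^-1 by eexists.
rewrite -deltaE in Ne.
have delta0 : 0 < delta by rewrite deltaE invr_gt0.
(* Centres within [delta / 2] put the points inside the balls of radius [delta], and
   [delta / 2 + delta <= e] keeps these balls inside [O]. *)
have N0 : 0 < delta / 2 by rewrite divr_gt0.
have [qw qwP] := ratv_approx (w x) N0.
have [qt qtP] := ratv_approx p.1 N0.
have [qa qaP] := rat_approx p.2 N0.
exists (qw, (qt, qa), N) => //; rewrite /E asboolT /wball /pball /= -deltaE.
  split; first by apply: ball_sym; apply: le_ball qwP; rewrite /=; lra.
  exists p; split => //; apply/nbhs_ballP; exists (delta / 2) => //= p' pp'.
  rewrite [delta]splitr; apply: ball_triangle pp'.
  by split; exact: ball_sym.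
move=> [w' p'] [/= w'P /interior_subset p'P]; apply: eO; split => /=.
  have : delta / 2 + delta <= e by lra.
  by move=> /le_ball; apply; exact: ball_triangle qwP w'P.
have : delta / 2 + delta <= e by lra.
move=> /le_ball; apply; apply: ball_triangle p'P.
by split.
Qed.

End hit_measurability.

Section normal_integrands.
Context {d} {X : measurableType d} {R : realType} {n : nat}.
Variable f : X -> 'rV[R]_n -> \bar R.
Hypothesis f_normal : normal_integrand f.

Let f_hit U : open U -> measurable [set x | epigraph (f x) `&` U !=set0].
Proof. by case: f_normal => _ _; exact. Qed.

(** As the epigraph is closed, [f x (s x) <= c] holds iff the epigraph meets every ball around
    [(s x, c)], which is a countable intersection of hitting conditions. *)
Lemma measurable_normal_comp (s : X -> 'rV[R]_n) : measurable_vec s ->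
  measurable_fun setT (fun x => f x (s x)).
Proof.
move=> ms; apply: (measurability (@ErealGenOInfty.G R)).
  exact: ErealGenOInfty.measurableE.
move=> _ [_ [c ->] <-]; rewrite setTI preimage_itvoy.
rewrite (_ : mkset _ = ~` [set x | (f x (s x) <= c%:E)%E]); last first.
  by apply/seteqP; split=> x /=; rewrite ltNge; [move/negP|move=> /negP].
apply: measurableC.
pose O N : set ('rV[R]_n * ('rV[R]_n * R)) :=
  [set wp | ball (wp.1, c) N.+1%:R^-1 wp.2]°.
rewrite (_ : mkset _ = \bigcap_N
    [set x | exists p, epigraph (f x) p /\ O N (s x, p)]).
  apply: bigcapT_measurable => N; apply: measurable_hit => //.
  exact: open_interior.
apply/seteqP; split=> x /=.
  move=> fxs N _; exists (s x, c); split => //.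
  have [e eE] : exists e : R, e = N.+1%:R^-1 by eexists.
  have e0 : 0 < e by rewrite eE invr_gt0.
  rewrite /O -eE; apply/nbhs_ballP.
  exists (e / 2); rewrite /= ?divr_gt0// => -[w p] [/= sw sp].
  rewrite [e]splitr.
  apply: (@ball_triangle _ _ (s x, c)) => //.
  by split; [exact: ball_sym|apply: ballxx; rewrite divr_gt0].
move=> fxs.
case: f_normal => _ /(_ x) fx_closed _.
apply: (fx_closed (s x, c)) => B /nbhs_ballP[e /= e0 eB].
have [N _ /(_ N (leqnn N)) Ne] := near_infty_natSinv_lt (PosNum e0).
have [p [fp /interior_subset pO]] := fxs N I.
by exists p; split => //; apply: eB; apply: le_ball pO; exact: ltW.
Qed.

Lemma conjugate_gtP (p : 'rV[R]_n) (c : R) x :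
  (c%:E < conjugate (f x) p)%E <->
  exists q, epigraph (f x) q /\ c < \sum_(k < n) p 0 k * q.1 0 k - q.2.
Proof.
case: f_normal => f_Ny _ _.
split=> [/ereal_sup_gt[_ [t _ <-]]|[[t a] [fta cta]]].
  case ft : (f x t) => [a| |].
  - rewrite -EFinB lte_fin => cta; exists (t, a); split => //.
    by rewrite /epigraph/= ft.
  - by rewrite addeNy.
  - by have := f_Ny x t; rewrite ft.
apply: lt_le_trans (_ : ((\sum_(k < n) p 0 k * t 0 k)%:E - f x t <= _)%E).
  apply: lt_le_trans (_ : ((\sum_(k < n) p 0 k * t 0 k)%:E - a%:E <= _)%E).
    by rewrite -EFinB lte_fin.
  by rewrite leeD2l// leeN2.
by apply: ereal_sup_ubound; exists t.
Qed.

(** By [conjugate_gtP], a strict superlevel set consists of the [x] at which the epigraph hits an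
    open condition involving [p x]. *)
Lemma measurable_conjugate (p : X -> 'rV[R]_n) : measurable_vec p ->
  measurable_fun setT (fun x => conjugate (f x) (p x)).
Proof.
move=> mp; apply: (measurability (@ErealGenOInfty.G R)).
  exact: ErealGenOInfty.measurableE.
move=> _ [_ [c ->] <-]; rewrite setTI preimage_itvoy.
pose F (wq : 'rV[R]_n * ('rV[R]_n * R)) :=
  \sum_(k < n) wq.1 0 k * wq.2.1 0 k - wq.2.2.
rewrite (_ : mkset _ =
    [set x | exists q, epigraph (f x) q /\ (F @^-1` `]c, +oo[) (p x, q)]).
  apply: measurable_hit => //.
  apply: open_comp; last exact: interval_open.
  move=> [w [t a]] _; apply: cvgB; last first.
    apply: (@cvg_comp _ _ _ snd snd _ (nbhs (t, a))); exact: cvg_snd.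
  apply: (@cvg_big R 'I_n +%R 0 predT) => [|k _]; first exact: add_continuous.
  apply: cvgM.
    apply: (@cvg_comp _ _ _ fst (fun t : 'rV[R]_n => t 0 k) _ (nbhs w)).
      exact: cvg_fst.
    exact: coord_continuous.
  apply: (@cvg_comp _ _ _ (fun wp : 'rV[R]_n * ('rV[R]_n * R) => wp.2.1)
    (fun t : 'rV[R]_n => t 0 k) _ (nbhs t)); last exact: coord_continuous.
  by apply: (@cvg_comp _ _ _ snd fst _ (nbhs (t, a)));
    [exact: cvg_snd|exact: cvg_fst].
apply/seteqP; split=> x /=.
  by move=> /conjugate_gtP[q [fq cq]]; exists q; rewrite in_itv/= cq.
move=> [q [fq]]; rewrite in_itv/= andbT => cq; apply/conjugate_gtP.
by exists q.
Qed.

Section prox_selection.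
Variable eps : R.
Hypothesis eps0 : 0 < eps.
Hypothesis f_convex : forall x, convex_ereal (f x).
Hypothesis f_ge0 : forall x t, (0 <= f x t)%E.
Hypothesis f_dom : forall x t, (f x t < +oo)%E -> forall k, 0 <= t 0 k.
Hypothesis f_pos : forall x, exists t : 'rV[R]_n,
  (forall k, 0 < t 0 k) /\ (f x t < +oo)%E.
Variable z : X -> 'rV[R]_n.
Hypothesis mz : measurable_vec z.
Hypothesis z_gt0 : forall x k, 0 < z x 0 k.

Lemma measurable_energy_hit (U : set R) k (c : R) : open U ->
  measurable [set x | exists p, epigraph (f x) p /\
    (U (p.1 0 k) /\ prox_energy eps (z x) p < c)].
Proof.
move=> oU.
(* Positivity of [wp.1] is part of [O] because the continuity of the energy is established only
   there. *)
pose O := [set wp : 'rV[R]_n * ('rV[R]_n * R) |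
  (forall j, 0 < wp.1 0 j) /\ U (wp.2.1 0 k) /\ prox_energy eps wp.1 wp.2 < c].
rewrite (_ : mkset _ = [set x | exists p, epigraph (f x) p /\ O (z x, p)]).
  apply: measurable_hit => //; rewrite openE => -[w [t a]] [/= w0 [Ut Ec]].
  have near_w0 : \forall wp \near (w, (t, a)),
      forall j : 'I_n, 0 < (wp.1 : 'rV[R]_n) 0 j.
    apply: (@filter_forall _ 'I_n
      (fun j => [set wp : 'rV[R]_n * ('rV[R]_n * R) | 0 < wp.1 0 j])
      (nbhs (w, (t, a))) (nbhs_filter _)) => j.
    have : (fun wp : 'rV[R]_n * ('rV[R]_n * R) => wp.1 0 j) @ (w, (t, a))
        --> w 0 j.
      apply: (@cvg_comp _ _ _ fst (fun t : 'rV[R]_n => t 0 j) _ (nbhs w)).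
        exact: cvg_fst.
      exact: coord_continuous.
    move=> /(_ [set r | 0 < r]); apply.
    by apply: open_nbhs_nbhs; split; [exact: open_gt|exact: w0].
  apply: filterI near_w0 _; apply: filterI.
    have : (fun wp : 'rV[R]_n * ('rV[R]_n * R) => wp.2.1 0 k) @ (w, (t, a))
        --> t 0 k.
      apply: (@cvg_comp _ _ _ (fun wp : 'rV[R]_n * ('rV[R]_n * R) => wp.2.1)
        (fun t : 'rV[R]_n => t 0 k) _ (nbhs t)); last exact: coord_continuous.
      by apply: (@cvg_comp _ _ _ snd fst _ (nbhs (t, a)));
    [exact: cvg_snd|exact: cvg_fst].
    by move=> /(_ U); apply; apply: open_nbhs_nbhs.
  have /(_ [set r | r < c]) :=
    continuous_prox_energy (eps := eps) (p := (t, a)) w0.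
  apply.
  by apply: open_nbhs_nbhs; split; [exact: open_lt|].
apply/seteqP; split=> x [p [fp pO]]; exists p; split => //.
  by split => // j; exact: z_gt0.
by case: pO.
Qed.

(* [m x 0 k < c] iff for some rationals [q < c] and [r] the energy takes values
   below [r] on the half-space [t 0 k < q] but not on [q < t 0 k]. *)
Lemma measurable_prox_point (m : X -> 'rV[R]_n) :
  (forall x, prox_point eps (f x) (z x) (m x)) -> measurable_vec m.
Proof.
move=> m_prox k.
apply: (measurability (@RGenInftyO.G R)); first exact: RGenInftyO.measurableE.
move=> _ [_ [c ->] <-]; rewrite setTI preimage_itvNyo.
pose E (U : set R) (r : rat) := [set x | exists p, epigraph (f x) p /\
    (U (p.1 0 k) /\ prox_energy eps (z x) p < ratr r)].
rewrite (_ : mkset _ = \bigcup_(q in [set q : rat | ratr q < c])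
    \bigcup_r (E `]-oo, ratr q[%classic r `\` E `]ratr q, +oo[%classic r)).
  rewrite bigcup_mkcond; apply: bigcupT_measurable_rat => q; case: ifP => // _.
  apply: bigcupT_measurable_rat => r.
  by apply: measurableD; apply: measurable_energy_hit; exact: interval_open.
have f_fin x t : (f x t < +oo)%E -> f x t = (fine (f x t))%:E.
  by move=> gt; rewrite fineK// ge0_fin_numE.
(* The minimal energy at [x]; [growth] separates it from the energy of points away from [m x]. *)
pose mu x := fine (f x (m x)) + eps * klv (m x) (z x).
have growth x p : epigraph (f x) p ->
    mu x + eps * klv p.1 (m x) <= prox_energy eps (z x) p.
  move=> fp; have ft : (f x p.1 < +oo)%E := le_lt_trans fp (ltry _).
  have := prox_point_growth eps0 (f_convex x) (f_ge0 x) (@f_dom x) (f_pos x)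
    (z_gt0 x) (m_prox x) p.1.
  have fp' : fine (f x p.1) <= p.2 by rewrite -lee_fin -f_fin.
  rewrite (f_fin _ _ ft) (f_fin _ _ (m_prox x).1) -!EFinD lee_fin.
  by rewrite prox_energyE ?/mu; [lra|by []|exact: f_dom ft].
have m_gt0 x j : 0 < m x 0 j.
  by apply: (prox_point_gt0 eps0 (f_convex x) _ _ (f_pos x) (z_gt0 x)
    (m_prox x));
    [exact: f_ge0|exact: f_dom].
apply/seteqP; split=> x /=.
  move=> /rat_in_itvoo[q]; rewrite in_itv/= => /andP[mq qc].
  exists q => //.
  have q0 : 0 < ratr q :> R by exact: lt_trans mq.
  (* Beyond [q] the energy exceeds the minimum by at least this amount, so a rational [r] in between
     separates the two half-spaces. *)
  have gap : 0 < eps * kl (ratr q) (m x 0 k).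
    by rewrite mulr_gt0// kl_gt0// gt_eqF.
  have : mu x < mu x + eps * kl (ratr q) (m x 0 k) by rewrite ltrDl.
  move=> /rat_in_itvoo[r]; rewrite in_itv/= => /andP[mur rmu].
  exists r => //; split.
    exists (m x, fine (f x (m x))); split => /=.
      by rewrite /epigraph/= -f_fin ?(m_prox x).1.
    rewrite in_itv/= mq; split => //; rewrite prox_energyE//= => j.
    exact/ltW/m_gt0.
  move=> [p [fp [/=]]]; rewrite in_itv/= andbT => qp.
  apply/negP; rewrite -leNgt; apply: le_trans (ltW rmu) _.
  apply: le_trans (growth _ _ fp); rewrite lerD2l ler_pM2l//.
  have kl_le : kl (p.1 0 k) (m x 0 k) <= klv p.1 (m x).
    by rewrite /klv (bigD1 k)//= lerDl; apply: sumr_ge0 => j _; exact: kl_ge0.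
  apply: le_trans kl_le.
  rewrite (kl_three_points (ltW (lt_trans q0 qp)) q0 (m_gt0 x k)).
  have := kl_ge0 (p.1 0 k) q0.
  have : 0 <= ln (ratr q / m x 0 k) * (p.1 0 k - ratr q).
    by rewrite mulr_ge0 ?subr_ge0 ?(ltW qp)// ln_ge0// ler_pdivlMr// mul1r ltW.
  lra.
(* Conversely, if [q < m x 0 k] then the minimizer itself has energy below [r] in the half-space
   that [noE] excludes. *)
move=> [q qc [r _ [[p [fp [_ pr]]] noE]]].
apply: le_lt_trans qc; rewrite leNgt; apply/negP => qm; apply: noE.
exists (m x, fine (f x (m x))); split => /=.
  by rewrite /epigraph/= -f_fin ?(m_prox x).1.
split; first by rewrite in_itv/= qm.
rewrite prox_energyE//=; last by move=> j; exact/ltW/m_gt0.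
apply: le_lt_trans pr; apply: le_trans (growth _ _ fp).
by rewrite -/(mu x) lerDl mulr_ge0 ?(ltW eps0)// klv_ge0.
Qed.

End prox_selection.
End normal_integrands.

(** * Integral functionals *)

Section integral_lemmas.
Context {d} {X : measurableType d} {R : realType}.
Variable mu : {measure set X -> \bar R}.
Local Open Scope ereal_scope.

Lemma convex_integral_ge0 (g : X -> \bar R) : (forall x, 0 <= g x) ->
  convex_integral mu g = \int[mu]_x g x.
Proof.
move=> g0; rewrite /convex_integral.
rewrite (eq_integral g) => [|x _]; last first.
  by rewrite (@ge0_funeposE _ _ setT) ?inE.
by case: eqP => [->|].
Qed.

(** Writing the inverse of [x] as [x] times the power -1 of its square reduces to [powR] on
    nonnegative reals; the formula also holds at 0. *)
Lemma measurable_inv : measurable_fun [set: R] (@GRing.inv R).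
Proof.
apply: (@eq_measurable_fun _ _ R R setT
  (fun x : R => x * (x ^+ 2) `^ (- 1))%R) => [x _|].
  rewrite powR_inv1 ?sqr_ge0//; have [->|x0] := eqVneq x 0%R.
    by rewrite invr0 mul0r.
  by rewrite expr2 invfM mulrA divff// mul1r.
apply: measurable_funM => //.
apply: (@measurableT_comp _ _ _ _ _ _ (fun y => y `^ (- 1))%R setT).
  exact: measurable_powR.
exact: exprn_measurable.
Qed.

Lemma measurable_div (g h : X -> R) :
  measurable_fun setT g -> measurable_fun setT h ->
  measurable_fun setT (fun x => g x / h x)%R.
Proof.
move=> mg mh; apply: measurable_funM => //.
exact: (measurableT_comp measurable_inv).
Qed.

Lemma measurable_kl (g h : X -> R) :
  measurable_fun setT g -> measurable_fun setT h ->
  measurable_fun setT (fun x => kl (g x) (h x)).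
Proof.
move=> mg mh; apply: measurable_funD => //; apply: measurable_funB => //.
apply: measurable_funM => //; apply: measurableT_comp => //.
exact: measurable_div.
Qed.

Lemma measurable_klv n (t z : X -> 'rV[R]_n) :
  measurable_vec t -> measurable_vec z ->
  measurable_fun setT (fun x => klv (t x) (z x)).
Proof. by move=> mt mz; apply: measurable_sum => k; exact: measurable_kl. Qed.

Lemma integral_klv n (t z : X -> 'rV[R]_n) :
  (forall x k, 0 < z x 0 k)%R -> measurable_vec t -> measurable_vec z ->
  \sum_(k < n) \int[mu]_x (kl (t x 0%R k) (z x 0%R k))%:E =
  \int[mu]_x (klv (t x) (z x))%:E.
Proof.
move=> z0 mt mz; rewrite -ge0_integral_sum//.
- by apply: eq_integral => x _; rewrite sumEFin.
- by move=> k; apply/measurable_EFinP; exact: measurable_kl.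
- by move=> k x _; rewrite lee_fin kl_ge0.
Qed.

End integral_lemmas.

(** * Integrated primal and dual problems of one half-step *)

Section prox_step.
Context {d} {X : measurableType d} {R : realType} {n : nat}.
Variables (mu : {measure set X -> \bar R}) (eps : R).
Variables (f : X -> 'rV[R]_n -> \bar R) (z : X -> 'rV[R]_n).
Hypothesis eps0 : 0 < eps.
Hypothesis f_adm : admissible mu f.
Hypothesis f_pos : forall x, exists t : 'rV[R]_n,
  (forall k, 0 < t 0 k) /\ (f x t < +oo)%E.
Hypothesis mz : measurable_vec z.
Hypothesis z_gt0 : forall x k, 0 < z x 0 k.

Let f_normal : normal_integrand f. Proof. by case: f_adm. Qed.
Let f_convex x : convex_ereal (f x). Proof. by case: f_adm => _ []. Qed.
Let f_ge0 x t : (0 <= f x t)%E. Proof. by case: f_adm => _ [_ []]. Qed.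
Let f_dom x t : (f x t < +oo)%E -> forall k, 0 <= t 0 k.
Proof. by case: f_adm => _ [_ [_ [+ _]]]; exact. Qed.

(** Plain choice suffices, as [measurable_prox_point] applies to every family of pointwise
    minimizers. *)
Lemma prox_selection_exists : exists m : X -> 'rV[R]_n,
  measurable_vec m /\ forall x, prox_point eps (f x) (z x) (m x).
Proof.
have /choice[m m_prox] x : exists m, prox_point eps (f x) (z x) m.
  apply: prox_point_exists => //; [by case: f_normal|exact: f_dom|].
  by have [t [_ ft]] := f_pos x; exists t.
by exists m; split => //; exact: measurable_prox_point m_prox.
Qed.

Variable m : X -> 'rV[R]_n.
Hypothesis mm : measurable_vec m.
Hypothesis m_prox : forall x, prox_point eps (f x) (z x) (m x).

Let m_gt0 x k : 0 < m x 0 k.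
Proof.
exact: (prox_point_gt0 eps0 (f_convex x) (f_ge0 x) (@f_dom x) (f_pos x)
  (z_gt0 x) (m_prox x)).
Qed.

Let phi x := fine (f x (m x)) + eps * klv (m x) (z x).

Let phi_ge0 x : 0 <= phi x.
Proof. by rewrite addr_ge0 ?fine_ge0// mulr_ge0 ?klv_ge0// ltW. Qed.

Let mphi : measurable_fun setT phi.
Proof.
apply: measurable_funD.
  by apply: measurableT_comp => //; exact: measurable_normal_comp.
by apply: measurable_funM => //; exact: measurable_klv.
Qed.

Let phiE x : (phi x)%:E = (f x (m x) + (eps * klv (m x) (z x))%:E)%E.
Proof. by rewrite EFinD fineK// ge0_fin_numE//; case: (m_prox x). Qed.

Local Open Scope ereal_scope.

Let proxE s : measurable_vec s ->
  integral_functional mu f s + eps%:E * \sum_(k < n) \int[mu]_x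
    (kl (s x 0%R k) (z x 0%R k))%:E =
  \int[mu]_x (f x (s x) + (eps * klv (s x) (z x))%:E).
Proof.
move=> ms; rewrite integral_klv//.
rewrite /integral_functional convex_integral_ge0//.
rewrite -ge0_integralZl_EFin//; last 3 first.
- by move=> x _; rewrite lee_fin klv_ge0.
- by apply/measurable_EFinP; exact: measurable_klv.
- exact: ltW.
rewrite -ge0_integralD//.
- exact: measurable_normal_comp.
- by move=> x _; rewrite mule_ge0 ?lee_fin ?klv_ge0// ltW.
- by apply: measurable_funeM; apply/measurable_EFinP; exact: measurable_klv.
Qed.

(** The integrated growth inequality against the competitor [m] gives that the integrals of [phi]
    and of [eps * klv (s x) (m x)] add up to at most the integral of [phi]. The latter is finite
    because the value at [s] is, so the divergence vanishes almost everywhere. *)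
Lemma proxKL_ae s : proxKL mu eps f z s ->
  {ae mu, forall x, s x = m x} /\ \int[mu]_x (phi x)%:E < +oo.
Proof.
case=> ms J_fin J_min.
have eps_oo : eps%:E * +oo = +oo by rewrite gt0_muley.
have Jm : integral_functional mu f m + eps%:E * KL mu m z =
    \int[mu]_x (phi x)%:E.
  rewrite /KL asboolT; last first.
    by apply: nearW => x k; split; rewrite ?(ltW (m_gt0 _ _)) ?(ltW (z_gt0 _ _))//;
      move=> zx0; have := z_gt0 x k; rewrite zx0 ltxx.
  rewrite (proxE mm).
  by apply: eq_integral => x _; rewrite phiE.
have Js : integral_functional mu f s + eps%:E * KL mu s z =
    \int[mu]_x (f x (s x) + (eps * klv (s x) (z x))%:E).
  (* If the sign conditions failed, [KL] and hence the objective would be [+oo], against the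
     finiteness built into [argmin]. *)
  rewrite -(proxE ms) /KL; case: asboolP => // noKL.
  move: J_fin; rewrite /KL asboolF// eps_oo addey ?ltxx//.
  rewrite /integral_functional convex_integral_ge0// gt_eqF//.
  by apply: lt_le_trans (integral_ge0 _ _) => //; rewrite ltNyr.
have mE : measurable_fun setT
    (fun x => f x (s x) + (eps * klv (s x) (z x))%:E).
  apply: emeasurable_funD; first exact: measurable_normal_comp.
  apply/measurable_EFinP; apply: measurable_funM => //; exact: measurable_klv.
have m_klv : measurable_fun setT (fun x => (eps * klv (s x) (m x))%:E).
  apply/measurable_EFinP; apply: measurable_funM => //; exact: measurable_klv.
have klv_ge0' x : 0 <= (eps * klv (s x) (m x))%:E.
  by rewrite lee_fin mulr_ge0 ?klv_ge0// ltW.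
have Em : \int[mu]_x (phi x)%:E + \int[mu]_x (eps * klv (s x) (m x))%:E <=
    \int[mu]_x (f x (s x) + (eps * klv (s x) (z x))%:E).
  rewrite -ge0_integralD//.
  - apply: ge0_le_integral => // [x _|  |x _].
    + by rewrite adde_ge0// lee_fin.
    + by apply: emeasurable_funD => //; exact/measurable_EFinP.
    + rewrite -EFinD /phi -addrA -mulrDr.
      have := prox_point_growth eps0 (f_convex x) (f_ge0 x) (@f_dom x) (f_pos x)
        (z_gt0 x) (m_prox x) (s x).
      by rewrite EFinD fineK// ge0_fin_numE//; case: (m_prox x).
  - by move=> x _; rewrite lee_fin.
  - exact/measurable_EFinP.
have := J_min m mm; rewrite Jm Js => sm.
have phi_fin : \int[mu]_x (phi x)%:E < +oo.
  apply: le_lt_trans (_ : _ <= _) J_fin; rewrite Js; apply: le_trans Em.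
  by rewrite leeDl// integral_ge0.
split => //.
have klv0 : \int[mu]_x `|(eps * klv (s x) (m x))%:E| = 0.
  under eq_integral do rewrite gee0_abs//.
  apply/eqP; rewrite eq_le integral_ge0// andbT.
  have := le_trans Em sm; rewrite -{2}[\int[mu]_x (phi x)%:E]adde0 leeD2lE//.
  by rewrite ge0_fin_numE// integral_ge0// => x _; rewrite lee_fin.
have := (ae_eq_integral_abs mu measurableT m_klv).1 klv0.
apply: filterS => x /(_ I)/= [] /eqP; rewrite mulf_eq0 gt_eqF//= /klv.
rewrite psumr_eq0; last by move=> k _; exact: kl_ge0.
move=> /allP kl0; apply/rowP => k; apply: (kl_eq0 (m_gt0 x k)).
by apply/eqP; apply: kl0; rewrite mem_index_enum.
Qed.

(** The dual objective with the marginal abstracted into [kz], so that an everywhere positive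
    version can replace the kernel operator. *)
Definition dual_fun (kz : 'I_n -> X -> \bar R) (u : X -> 'rV[R]_n) : \bar R :=
  - integral_functional mu (fun x => conjugate (f x)) (fun x => - u x)%R
  - eps%:E * \sum_(k < n) \int[mu]_x ((exp_vec eps u x 0%R k)%:E * kz k x).

(** Only the positive part of the conjugate is constrained: the inequality [gap] controls its
    negative part. *)
Definition dual_feasible (kz : 'I_n -> X -> \bar R) (u : X -> 'rV[R]_n) :
    Prop :=
  [/\ measurable_vec u,
      \int[mu]_x ((fun x => conjugate (f x) (- u x)%R)^\+ x) < +oo &
      forall k, \int[mu]_x ((exp_vec eps u x 0%R k)%:E * kz k x) < +oo].

Lemma dual_fun_feasible kz u : (forall k x, 0 <= kz k x) -> measurable_vec u ->
  -oo < dual_fun kz u -> dual_feasible kz u.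
Proof.
move=> kz0 mu_; rewrite /dual_fun => uNy.
have int0 k : 0 <= \int[mu]_x ((exp_vec eps u x 0%R k)%:E * kz k x).
  by apply: integral_ge0 => x _; rewrite mule_ge0// lee_fin mxE expR_ge0.
have sumy : \sum_(k < n) \int[mu]_x ((exp_vec eps u x 0%R k)%:E * kz k x) < +oo.
  rewrite ltey; apply/eqP => sumy; move: uNy.
  by rewrite sumy gt0_muley ?lte_fin// addeNy ltxx.
split => // [|k].
  rewrite ltey; apply/eqP => posy; move: uNy.
  by rewrite /integral_functional /convex_integral posy eqxx addNye ltxx.
apply: le_lt_trans sumy; rewrite (bigD1 k)//= leeDl//.
by apply: sume_ge0 => j _.
Qed.

Let zE k x := (z x 0%R k)%:E.
Let Z x := (\sum_(k < n) z x 0 k)%R.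
Let M x := (\sum_(k < n) m x 0 k)%R.
(** The primal density attached to a dual candidate [u]; it equals [m] when [u] is the pointwise
    dual optimum. *)
Let wv (u : X -> 'rV[R]_n) x : 'rV[R]_n :=
  (\row_k (z x 0 k * expR (u x 0 k / eps)))%R.
Let W u x := (\sum_(k < n) wv u x 0 k)%R.
Let c (u : X -> 'rV[R]_n) x := conjugate (f x) (- u x)%R.

Let wv_gt0 u x k : (0 < wv u x 0 k)%R.
Proof. by rewrite mxE mulr_gt0// expR_gt0. Qed.

Let mwv u : measurable_vec u -> measurable_vec (wv u).
Proof.
move=> mu_ k; apply: (eq_measurable_fun
    (fun x => z x 0 k * expR (u x 0 k * eps^-1)))%R => [x _|].
  by rewrite mxE.
apply: measurable_funM => //; apply: measurableT_comp => //.
exact: measurable_funM.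
Qed.

Let integrable_ge0 (g : X -> R) : measurable_fun setT g ->
  (forall x, 0 <= g x)%R -> \int[mu]_x (g x)%:E < +oo ->
  mu.-integrable setT (EFin \o g).
Proof.
move=> mg g0 gy; apply/integrableP; split; first exact/measurable_EFinP.
by under eq_integral do rewrite /= ger0_norm//.
Qed.

Let mZ : measurable_fun setT Z. Proof. exact: measurable_sum. Qed.
Let mM : measurable_fun setT M. Proof. exact: measurable_sum. Qed.
Let mW u : measurable_vec u -> measurable_fun setT (W u).
Proof. by move=> /mwv mwu; exact: measurable_sum. Qed.
Let mc u : measurable_vec u -> measurable_fun setT (c u).
Proof.
move=> mu_; apply: measurable_conjugate => // k.
apply: (eq_measurable_fun (fun x => - (u x 0 k))%R) => [x _|].
  by rewrite mxE.
exact: measurableT_comp.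
Qed.
Let epsM0 g : (forall x : X, 0 <= g x)%R -> forall x, (0 <= eps * g x)%R.
Proof. by move=> g0 x; rewrite mulr_ge0// ltW. Qed.
Let mepsM g : measurable_fun [set: X] g ->
  measurable_fun setT (fun x => eps * g x)%R.
Proof. by move=> mg; exact: measurable_funM. Qed.
Let Z0 x : (0 <= Z x)%R. Proof. by apply: sumr_ge0 => k _; exact: ltW. Qed.
Let M0 x : (0 <= M x)%R. Proof. by apply: sumr_ge0 => k _; exact: ltW. Qed.
Let W0 u x : (0 <= W u x)%R. Proof. by apply: sumr_ge0 => k _; exact: ltW. Qed.

Let epsW u : measurable_vec u ->
  eps%:E * \sum_(k < n) \int[mu]_x ((exp_vec eps u x 0%R k)%:E * zE k x) =
  \int[mu]_x (eps * W u x)%:E.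
Proof.
move=> mu_; under [RHS]eq_integral do rewrite EFinM.
rewrite ge0_integralZl_EFin//; last 3 first.
- by move=> x _; rewrite lee_fin.
- by apply/measurable_EFinP; exact: mW.
- exact: ltW.
congr (_ * _); rewrite -ge0_integral_sum//.
- apply: eq_integral => x _; rewrite -sumEFin; apply: eq_bigr => k _.
  by rewrite !mxE EFinM muleC.
- move=> k; apply: (eq_measurable_fun (fun x => (wv u x 0%R k)%:E)) => [x _|].
    by rewrite !mxE EFinM muleC.
  by apply/measurable_EFinP; exact: mwv.
- by move=> k x _; rewrite mule_ge0// lee_fin ?mxE ?expR_ge0// ltW.
Qed.

Let gap u x : (eps * Z x + eps * klv (m x) (wv u x))%:E <=
  c u x + (eps * W u x + phi x)%:E.
Proof.
rewrite -mulrDr.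
apply: (prox_dual_gap eps0 (f_convex x) (f_ge0 x) (@f_dom x) (f_pos x)
  (z_gt0 x) (m_prox x)) => k.
by rewrite mxE.
Qed.

Let feasible_int u : dual_feasible zE u ->
  mu.-integrable setT (EFin \o (fun x => eps * W u x)%R).
Proof.
move=> [mu_ _ uy]; apply: integrable_ge0.
- by apply: mepsM; exact: mW.
- exact: epsM0.
- rewrite -epsW// lte_mul_pinfty// ?lee_fin ?ltW//.
  by apply: lte_sum_pinfty => k _; exact: uy.
Qed.

Hypothesis phi_fin : \int[mu]_x (phi x)%:E < +oo.

Let phi_int : mu.-integrable setT (EFin \o phi).
Proof. exact: integrable_ge0. Qed.

Let CP_int u : dual_feasible zE u ->
  mu.-integrable setT (EFin \o (fun x => eps * W u x + phi x)%R).
Proof.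
move=> /feasible_int Wint; have := integrableD measurableT Wint phi_int.
by apply: eq_integrable => // x _.
Qed.

(** Dropping the divergence in [gap] bounds [eps * Z] by the positive part of the conjugate plus
    [eps * W u + phi]. *)
Let Z_int u : dual_feasible zE u ->
  mu.-integrable setT (EFin \o (fun x => eps * Z x)%R).
Proof.
move=> ufeas; have [mu_ cy _] := ufeas.
have mcp : measurable_fun setT ((c u)^\+).
  by apply: measurable_funepos; exact: mc.
have := CP_int ufeas; set CP := EFin \o _ => CPint.
apply: integrable_ge0; [exact: mepsM|exact: epsM0|].
apply: (@le_lt_trans _ _ (\int[mu]_x ((c u)^\+ x + CP x))).
  apply: ge0_le_integral => //.
  - by move=> x _; rewrite lee_fin epsM0.
  - by apply/measurable_EFinP; exact: mepsM.
  - by apply: emeasurable_funD => //; exact: measurable_int CPint.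
  - move=> x _; apply: le_trans (le_trans (gap u x) _); last first.
      by apply: leeD2r; rewrite funeposE le_max lexx.
    by rewrite lee_fin lerDl mulr_ge0 ?klv_ge0// ltW.
rewrite ge0_integralD//.
- by rewrite lte_add_pinfty//; exact: integrable_lty.
- by move=> x _; rewrite lee_fin addr_ge0// epsM0.
- exact: measurable_int CPint.
Qed.

(** Coordinatewise, [ler_kl] bounds [eps * M] by [phi] plus [expR 1] times [eps * Z]. *)
Let M_int u0 : dual_feasible zE u0 ->
  mu.-integrable setT (EFin \o (fun x => eps * M x)%R).
Proof.
move=> /Z_int Zint.
have eZint := integrableZl measurableT (expR 1) Zint.
have := integrableD measurableT phi_int eZint.
apply: le_integrable => //; first by apply/measurable_EFinP; exact: mepsM.
move=> x _; rewrite /= lee_fin !ger0_norm ?epsM0//.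
  rewrite -mulrCA -lerBlDr -mulrBr.
  apply: le_trans (_ : _ <= eps * klv (m x) (z x))%R _; last first.
    by rewrite lerDr fine_ge0.
  rewrite ler_pM2l// /M /Z /klv mulr_sumr -sumrB; apply: ler_sum => k _.
  by rewrite lerBlDr ler_kl// ltW.
by rewrite addr_ge0// mulr_ge0 ?expR_ge0// epsM0.
Qed.

Let u x := prox_dual eps (z x) (m x).

Let mu_dual : measurable_vec u.
Proof.
move=> k; apply: (eq_measurable_fun
    (fun x => eps * ln (m x 0 k / z x 0 k)))%R => [x _|].
  by rewrite mxE.
apply: measurable_funM => //; apply: measurableT_comp => //.
exact: measurable_div.
Qed.

Let W_dual x : W u x = M x.
Proof.
apply: eq_bigr => k _; rewrite mxE.
exact: (expR_prox_dual eps0 (f_convex x) (f_ge0 x) (@f_dom x) (f_pos x)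
  (z_gt0 x) (m_prox x)).
Qed.

Let c_dual x : c u x = (eps * Z x - eps * M x - phi x)%:E.
Proof.
exact: (conjugate_prox_dual eps0 (f_convex x) (f_ge0 x) (@f_dom x) (f_pos x)
  (z_gt0 x) (m_prox x)).
Qed.

(** The conjugate at the dual optimum is [eps * Z - eps * M - phi] and the exponential term is
    [eps * M]. The feasible [u0] makes [Z] and [M] integrable, so that the masses of [m] cancel. *)
Lemma dual_fun_prox u0 : dual_feasible zE u0 ->
  dual_fun zE u = \int[mu]_x (phi x)%:E - \int[mu]_x (eps * Z x)%:E.
Proof.
move=> u0feas; have Zint := Z_int u0feas; have Mint := M_int u0feas.
have ZMint : mu.-integrable setT (EFin \o (fun x => eps * Z x - eps * M x)%R).
  have := integrableB measurableT Zint Mint.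
  by apply: eq_integrable => // x _.
have cint : mu.-integrable setT (c u).
  have := integrableB measurableT ZMint phi_int.
  by apply: eq_integrable => // x _; rewrite c_dual.
rewrite /dual_fun epsW//.
under [X in _ - X]eq_integral do rewrite W_dual.
rewrite /integral_functional /convex_integral -/(c u).
rewrite lt_eqF; last exact: integral_funepos_lt_pinfty.
have -> : \int[mu]_x c u x = \int[mu]_x (eps * Z x)%:E -
    \int[mu]_x (eps * M x)%:E - \int[mu]_x (phi x)%:E.
  rewrite -integralB_EFin//.
  transitivity (\int[mu]_x ((eps * Z x - eps * M x)%:E - (phi x)%:E)).
    by apply: eq_integral => x _; rewrite c_dual.
  by rewrite (integralB_EFin measurableT ZMint phi_int).
have Zfin := integrable_fin_num measurableT Zint.
have Mfin := integrable_fin_num measurableT Mint.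
have Pfin := integrable_fin_num measurableT phi_int.
rewrite -(fineK Zfin) -(fineK Mfin) -(fineK Pfin) /=.
by congr EFin; ring.
Qed.

Lemma dual_fun_gap u0 u' : dual_feasible zE u0 -> measurable_vec u' ->
  -oo < dual_fun zE u' ->
  dual_fun zE u' + \int[mu]_x (eps * klv (m x) (wv u' x))%:E <= dual_fun zE u.
Proof.
move=> u0feas mu' u'Ny.
have u'feas : dual_feasible zE u'.
  by apply: dual_fun_feasible => // k x; rewrite lee_fin ltW.
rewrite (dual_fun_prox u0feas).
have Zint := Z_int u0feas; have Wint := feasible_int u'feas.
have WPint := CP_int u'feas.
have mk : measurable_fun setT (fun x => (eps * klv (m x) (wv u' x))%:E).
  apply/measurable_EFinP; apply: mepsM; apply: measurable_klv => //.
  exact: mwv.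
have k0 x : (0 <= eps * klv (m x) (wv u' x))%R.
  by rewrite mulr_ge0 ?klv_ge0// ltW.
have [_ cy _] := u'feas.
have mc' := mc mu'.
(* Where the conjugate is negative, [gap] bounds its absolute value by [eps * W u' + phi]. *)
have cint : mu.-integrable setT (c u').
  apply/integrableP; split => //.
  apply: (@le_lt_trans _ _ (\int[mu]_x
    ((c u')^\+ x + (eps * W u' x + phi x)%:E))).
    apply: ge0_le_integral => //.
    - exact: measurableT_comp.
    - apply: emeasurable_funD; first exact: measurable_funepos.
      exact: measurable_int WPint.
    - move=> x _; have WP0 : (0 <= eps * W u' x + phi x)%R.
        by rewrite addr_ge0// epsM0.
      have [cx0|/ltW cx0] := leP 0 (c u' x).
        rewrite gee0_abs// (@ge0_funeposE _ _ [set x]) ?inE//;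
          last by move=> y ->.
        by rewrite leeDl// lee_fin.
      rewrite lee0_abs//; apply: le_trans (_ : (eps * W u' x + phi x)%:E <= _).
        rewrite leeNl -[leLHS]add0e leeBlDr//.
        apply: le_trans (gap u' x).
        by rewrite lee_fin addr_ge0// epsM0.
      by rewrite leeDr// funepos_ge0.
  rewrite ge0_integralD//.
  - by rewrite lte_add_pinfty//; exact: integrable_lty.
  - exact: measurable_funepos.
  - by move=> x _; rewrite lee_fin addr_ge0// epsM0.
  - exact: measurable_int WPint.
have key : \int[mu]_x (eps * Z x)%:E +
    \int[mu]_x (eps * klv (m x) (wv u' x))%:E <=
    \int[mu]_x c u' x + (\int[mu]_x (eps * W u' x)%:E + \int[mu]_x (phi x)%:E).
  rewrite -ge0_integralD//; last 3 first.
  - by move=> x _; rewrite lee_fin epsM0.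
  - by apply/measurable_EFinP; exact: mepsM.
  - by move=> x _; rewrite lee_fin.
  rewrite -(integralD_EFin measurableT Wint phi_int).
  rewrite -(integralD measurableT cint WPint).
  apply: ge0_le_integral => //.
  - by move=> x _; rewrite adde_ge0// lee_fin// epsM0.
  - by apply: emeasurable_funD => //; apply/measurable_EFinP; exact: mepsM.
  - by apply: emeasurable_funD => //; exact: measurable_int WPint.
  - by move=> x _; rewrite -EFinD; exact: gap.
rewrite /dual_fun epsW// /integral_functional /convex_integral -/(c u').
rewrite lt_eqF//.
move: key.
have Zfin := integrable_fin_num measurableT Zint.
have Wfin := integrable_fin_num measurableT Wint.
have Pfin := integrable_fin_num measurableT phi_int.
have cfin := integrable_fin_num measurableT cint.
have : 0 <= \int[mu]_x (eps * klv (m x) (wv u' x))%:E.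
  by apply: integral_ge0 => x _; rewrite lee_fin.
rewrite -(fineK Zfin) -(fineK Wfin) -(fineK Pfin) -(fineK cfin) /=.
(* All other terms of [key] being finite, this integral cannot be [+oo]. *)
case: (\int[mu]_x (eps * klv (m x) (wv u' x))%:E) => //= r _.
by rewrite !lee_fin; lra.
Qed.

(** For another maximizer [u'], the finite optimal value cancels in [dual_fun_gap], so [m] equals
    [z e^(u'/eps)] almost everywhere and injectivity of the exponential identifies [u']. *)
Lemma dual_fun_argmax u0 : dual_feasible zE u0 ->
  argmax measurable_vec (dual_fun zE) u /\
  forall u', argmax measurable_vec (dual_fun zE) u' ->
    {ae mu, forall x, u' x = u x}.
Proof.
move=> u0feas.
have int0 u' : 0 <= \int[mu]_x (eps * klv (m x) (wv u' x))%:E.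
  by apply: integral_ge0 => x _; rewrite lee_fin mulr_ge0 ?klv_ge0// ltW.
have /andP[uNy uy] : (-oo < dual_fun zE u) && (dual_fun zE u < +oo).
  rewrite -fin_numElt (dual_fun_prox u0feas) fin_numB.
  by rewrite !integrable_fin_num//; exact: Z_int u0feas.
split=> [|u' [mu' u'Ny u'max]].
  split; [exact: mu_dual|exact: uNy|move=> u' mu'].
  have [u'Ny|] := ltP -oo (dual_fun zE u'); last first.
    by rewrite leeNy_eq => /eqP ->; exact: leNye.
  by apply: le_trans (dual_fun_gap u0feas mu' u'Ny); rewrite leeDl.
have mk : measurable_fun setT (fun x => (eps * klv (m x) (wv u' x))%:E).
  apply/measurable_EFinP; apply: mepsM; apply: measurable_klv => //.
  exact: mwv.
have u'fin : dual_fun zE u' \is a fin_num.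
  rewrite fin_numElt u'Ny/=; apply: le_lt_trans uy.
  by apply: le_trans (dual_fun_gap u0feas mu' u'Ny); rewrite leeDl.
have k0 : \int[mu]_x `|(eps * klv (m x) (wv u' x))%:E| = 0.
  under eq_integral do
    rewrite gee0_abs ?lee_fin ?mulr_ge0 ?klv_ge0 ?(ltW eps0)//.
  apply/eqP; rewrite eq_le int0 andbT -(leeD2lE _ _ u'fin) adde0.
  exact: le_trans (dual_fun_gap u0feas mu' u'Ny) (u'max u mu_dual).
have := (ae_eq_integral_abs mu measurableT mk).1 k0.
apply: filterS => x /(_ I)/= [] /eqP; rewrite mulf_eq0 gt_eqF//= /klv.
rewrite psumr_eq0; last by move=> k _; exact: kl_ge0.
move=> /allP kl0; apply/rowP => k.
have /eqP/(kl_eq0 (wv_gt0 u' x k)) : kl (m x 0%R k) (wv u' x 0%R k) == 0%R.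
  by apply: kl0; rewrite mem_index_enum.
rewrite mxE -(expR_prox_dual eps0 (f_convex x) (f_ge0 x) (@f_dom x) (f_pos x)
  (z_gt0 x) (m_prox x)) => /(mulfI (lt0r_neq0 (z_gt0 x k)))/expR_inj.
by move=> /(mulIf (invr_neq0 (lt0r_neq0 eps0))).
Qed.

End prox_step.

(** * Kernel operators *)

Section almost_everywhere_invariance.
Context {d} {X : measurableType d} {R : realType} {n : nat}.
Variable mu : {measure set X -> \bar R}.
Local Open Scope ereal_scope.

Lemma eq_argmax (S : Type) (D : set S) (J J' : S -> \bar R) :
  (forall s, D s -> J s = J' s) -> argmax D J = argmax D J'.
Proof.
move=> JJ'; apply/seteqP; split=> s [Ds Js Jmax].
  split => // [|t Dt]; first by rewrite -JJ'.
  by rewrite -!JJ'//; exact: Jmax.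
split => // [|t Dt]; first by rewrite JJ'.
by rewrite !JJ'//; exact: Jmax.
Qed.

Lemma ae_eq_KL (r s s' : X -> 'rV[R]_n) :
  measurable_vec r -> measurable_vec s -> measurable_vec s' ->
  {ae mu, forall x, s x = s' x} -> KL mu r s = KL mu r s'.
Proof.
move=> mr ms ms' ss'; rewrite /KL.
congr (if _ then _ else _).
  apply/asbool_equiv_eq; split; apply: filterS2 ss' => x /= -> //.
apply: eq_bigr => k _; apply: ae_eq_integral => //.
- by apply/measurable_EFinP; exact: measurable_kl.
- by apply/measurable_EFinP; exact: measurable_kl.
- by apply: filterS ss' => x /= ->.
Qed.

Lemma ae_eq_proxKL eps (f : X -> 'rV[R]_n -> \bar R) (z z' s : X -> 'rV[R]_n) :
  measurable_vec z -> measurable_vec z' -> {ae mu, forall x, z x = z' x} ->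
  proxKL mu eps f z s -> proxKL mu eps f z' s.
Proof.
move=> mz mz' zz' [ms Js Jmin].
split => // [|t mt]; first by rewrite -(ae_eq_KL ms mz mz' zz').
by rewrite -(ae_eq_KL ms mz mz' zz') -(ae_eq_KL mt mz mz' zz'); exact: Jmin.
Qed.

Lemma measurable_exp_vec eps (u : X -> 'rV[R]_n) : measurable_vec u ->
  measurable_vec (exp_vec eps u).
Proof.
move=> mu_ k; apply: (eq_measurable_fun
    (fun x => expR (u x 0 k * eps^-1)))%R => [x _|]; first by rewrite mxE.
by apply: measurableT_comp => //; exact: measurable_funM.
Qed.

Lemma ae_eq_exp_integral eps (kz kz' : 'I_n -> X -> \bar R)
    (u : X -> 'rV[R]_n) k :
  measurable_fun setT (kz k) -> measurable_fun setT (kz' k) ->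
  {ae mu, forall x, kz k x = kz' k x} -> measurable_vec u ->
  \int[mu]_x ((exp_vec eps u x 0%R k)%:E * kz k x) =
  \int[mu]_x ((exp_vec eps u x 0%R k)%:E * kz' k x).
Proof.
move=> mk mk' kk' mu_.
have me : measurable_fun setT (fun x => (exp_vec eps u x 0%R k)%:E).
  by apply/measurable_EFinP; exact: measurable_exp_vec.
apply: ae_eq_integral => //; [exact: emeasurable_funM|exact: emeasurable_funM|].
by apply: filterS kk' => x /= ->.
Qed.

Lemma ae_eq_dual_fun eps (f : X -> 'rV[R]_n -> \bar R)
    (kz kz' : 'I_n -> X -> \bar R) (u : X -> 'rV[R]_n) :
  (forall k, measurable_fun setT (kz k)) ->
  (forall k, measurable_fun setT (kz' k)) ->
  {ae mu, forall x k, kz k x = kz' k x} -> measurable_vec u ->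
  dual_fun mu eps f kz u = dual_fun mu eps f kz' u.
Proof.
move=> mk mk' kk' mu_; rewrite /dual_fun; congr (_ - _ * _).
apply: eq_bigr => k _; apply: ae_eq_exp_integral => //.
by apply: filterS kk' => x; exact.
Qed.

Lemma ae_eq_dual_feasible eps (f : X -> 'rV[R]_n -> \bar R)
    (kz kz' : 'I_n -> X -> \bar R) (u : X -> 'rV[R]_n) :
  (forall k, measurable_fun setT (kz k)) ->
  (forall k, measurable_fun setT (kz' k)) ->
  {ae mu, forall x k, kz k x = kz' k x} ->
  dual_feasible mu eps f kz u -> dual_feasible mu eps f kz' u.
Proof.
move=> mk mk' kk' [mu_ cy ky]; split => // k.
rewrite -(@ae_eq_exp_integral eps kz)//.
by apply: filterS kk' => x; exact.
Qed.

End almost_everywhere_invariance.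

(** * Kernel operators applied to exponentials *)

Section kernel_operator.
Context {d1 d2} {X : measurableType d1} {Y : measurableType d2} {R : realType}.
Context {n : nat}.
Variables (Q : probability Y R) (eps : R) (K : 'I_n -> X * Y -> R).
Hypothesis mK : forall k, measurable_fun setT (K k).
Local Open Scope ereal_scope.

(** The integrand may change sign, so Tonelli measurability is applied to its positive and negative
    parts. *)
Lemma measurable_kernel_op (b : Y -> 'rV[R]_n) k : measurable_vec b ->
  measurable_fun setT (kernel_op Q K b k).
Proof.
move=> mb; pose g (p : X * Y) := (K k p * b p.2 0%R k)%:E.
have mg : measurable_fun setT g.
  apply/measurable_EFinP; apply: measurable_funM => //.
  by apply: (measurableT_comp (mb k)).
rewrite (_ : kernel_op Q K b k = 
    fun x => fubini_F Q (g^\+) x - fubini_F Q (g^\-) x).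
  apply: emeasurable_funB; apply: measurable_fun_fubini_tonelli_F.
  - exact: measurable_funepos.
  - by move=> p; exact: funepos_ge0.
  - exact: measurable_funeneg.
  - by move=> p; exact: funeneg_ge0.
apply/funext => x; rewrite /kernel_op integralE /fubini_F.
by congr (_ - _); apply: eq_integral => y _; rewrite ?funeposE ?funenegE.
Qed.

Lemma ae_eq_kernel_op (b b' : Y -> 'rV[R]_n) k x :
  measurable_vec b -> measurable_vec b' -> {ae Q, forall y, b y = b' y} ->
  kernel_op Q K b k x = kernel_op Q K b' k x.
Proof.
move=> mb mb' bb'.
have mKx : measurable_fun setT (fun y => K k (x, y)) by exact: measurableT_comp.
apply: ae_eq_integral => //.
- by apply/measurable_EFinP; exact: measurable_funM.
- by apply/measurable_EFinP; exact: measurable_funM.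
- by apply: filterS bb' => y /= ->.
Qed.

(** The kernel is positive only almost everywhere; with its absolute value the integrand is
    nonnegative everywhere, as Tonelli requires. *)
Definition abs_kernel_op (v : Y -> 'rV[R]_n) k x : \bar R :=
  \int[Q]_y (`|K k (x, y)| * exp_vec eps v y 0%R k)%:E.

Lemma abs_kernel_op_ge0 v k x : 0 <= abs_kernel_op v k x.
Proof.
apply: integral_ge0 => y _; rewrite lee_fin mulr_ge0//.
by rewrite mxE expR_ge0.
Qed.

Let mabs v k : measurable_vec v ->
  measurable_fun setT
    (fun p : X * Y => (`|K k p| * exp_vec eps v p.2 0%R k)%:E).
Proof.
move=> mv; apply/measurable_EFinP; apply: measurable_funM.
  exact: measurableT_comp.
exact: (measurableT_comp (measurable_exp_vec eps mv k)).
Qed.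

Lemma measurable_abs_kernel_op v k : measurable_vec v ->
  measurable_fun setT (abs_kernel_op v k).
Proof.
move=> mv; apply: (measurable_fun_fubini_tonelli_F _ (mabs k mv)) => p.
by rewrite lee_fin mulr_ge0// mxE expR_ge0.
Qed.

Lemma kernel_op_abs v k x : {ae Q, forall y, 0 < K k (x, y)}%R ->
  measurable_vec v ->
  kernel_op Q K (exp_vec eps v) k x = abs_kernel_op v k x.
Proof.
move=> K0 mv; have me := measurable_exp_vec eps mv k.
have mKx : measurable_fun setT (fun y => K k (x, y)) by exact: measurableT_comp.
apply: ae_eq_integral => //.
- by apply/measurable_EFinP; exact: measurable_funM.
- apply/measurable_EFinP; apply: measurable_funM => //; exact: measurableT_comp.
- by apply: filterS K0 => y /= Ky _; rewrite gtr0_norm.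
Qed.

Lemma abs_kernel_op_gt0 v k x : {ae Q, forall y, 0 < K k (x, y)}%R ->
  measurable_vec v -> 0 < abs_kernel_op v k x.
Proof.
move=> K0 mv; rewrite lt0e abs_kernel_op_ge0 andbT; apply/eqP => int0.
have me := measurable_exp_vec eps mv k.
have mKx : measurable_fun setT (fun y => K k (x, y)) by exact: measurableT_comp.
have mg : measurable_fun setT
    (fun y => (`|K k (x, y)| * exp_vec eps v y 0%R k)%:E).
  apply/measurable_EFinP; apply: measurable_funM => //; exact: measurableT_comp.
have := (ae_eq_integral_abs Q measurableT mg).1.
under eq_integral do rewrite gee0_abs ?lee_fin ?mulr_ge0 ?mxE ?expR_ge0//.
move=> /(_ _)/wrap[|g0].
  by rewrite -[RHS]int0; apply: eq_integral => y _; rewrite mxE.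
(* A vanishing integral would make the kernel zero almost everywhere, so the whole space would be
   null for a probability. *)
have : {ae Q, forall y : Y, False}.
  apply: filterS2 g0 K0 => y /(_ I)/= [] /eqP.
  rewrite mulf_eq0 normr_eq0 mxE (gt_eqF (expR_gt0 _)) orbF => /eqP ->.
  by rewrite ltxx.
move=> [N [mN N0 NT]]; have : Q setT <= Q N.
  by apply: le_measure; rewrite ?inE// => y _; apply: NT => /=.
by rewrite N0 probability_setT lee_fin ler10.
Qed.

End kernel_operator.

Section kernel_swap.
Context {d1 d2} {X : measurableType d1} {Y : measurableType d2} {R : realType}.
Context {n : nat}.
Variables (P : probability X R) (Q : probability Y R).
Variables (eps : R) (K : 'I_n -> X * Y -> R).
Hypothesis mK : forall k, measurable_fun setT (K k).
Local Open Scope ereal_scope.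

(** Both sides are iterated integrals of the same nonnegative function [g] on the product. *)
Lemma abs_kernel_op_swap u v k : measurable_vec u -> measurable_vec v ->
  \int[P]_x ((exp_vec eps u x 0%R k)%:E * abs_kernel_op Q eps K v k x) =
  \int[Q]_y ((exp_vec eps v y 0%R k)%:E *
             abs_kernel_op P eps (kernel_tr K) u k y).
Proof.
move=> mu_ mv.
have meu := measurable_exp_vec eps mu_ k.
have mev := measurable_exp_vec eps mv k.
pose g (p : X * Y) :=
  (exp_vec eps u p.1 0%R k * (`|K k p| * exp_vec eps v p.2 0%R k))%:E.
have mg : measurable_fun setT g.
  apply/measurable_EFinP; apply: measurable_funM.
    exact: (measurableT_comp meu).
  apply: measurable_funM; first exact: measurableT_comp.
  exact: (measurableT_comp mev).
have g0 p : 0 <= g p by rewrite lee_fin !mulr_ge0// mxE expR_ge0.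
transitivity (\int[P]_x \int[Q]_y g (x, y)).
  apply: eq_integral => x _; rewrite -ge0_integralZl_EFin//.
  - by move=> y _; rewrite lee_fin mulr_ge0// mxE expR_ge0.
  - apply/measurable_EFinP; apply: measurable_funM => //.
    by apply: measurableT_comp => //; exact: measurableT_comp.
  - by rewrite mxE expR_ge0.
rewrite (fubini_tonelli g)//; apply: eq_integral => y _.
rewrite -ge0_integralZl_EFin.
- apply: eq_integral => x _.
  by rewrite -EFinM /g /kernel_tr/=; congr EFin; ring.
- exact: measurableT.
- by move=> x _; rewrite lee_fin mulr_ge0// mxE expR_ge0.
- apply/measurable_EFinP; apply: measurable_funM => //.
  apply: measurableT_comp => //; rewrite /kernel_tr/=.
  exact: (measurableT_comp (mK k)).
- by rewrite mxE expR_ge0.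
Qed.

End kernel_swap.

(** * Propagation along the iterations *)

Section dual_coupling.
Context {d1 d2} {X : measurableType d1} {Y : measurableType d2} {R : realType}.
Context {n : nat}.
Local Open Scope ereal_scope.

(* Dual feasibility of the previous iterate [u0] (or of [0] for the first step)
   makes the marginal [K exp(v / eps)] integrable at the next step, so that the
   dual objective is not identically [-oo]. *)
Definition dual_coupled (P : probability X R) (Q : probability Y R) (eps : R)
    (f1 : X -> 'rV[R]_n -> \bar R) (f2 : Y -> 'rV[R]_n -> \bar R)
    (K : 'I_n -> X * Y -> R) (b v : Y -> 'rV[R]_n) : Prop :=
  [/\ measurable_vec b, measurable_vec v,
      {ae Q, forall y, b y = exp_vec eps v y},
      \int[Q]_y ((fun y => conjugate (f2 y) (- v y)%R)^\+ y) < +oo &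
      exists u0, dual_feasible P eps f1 (kernel_op Q K (exp_vec eps v)) u0].

Definition positive_kernel (P : probability X R) (Q : probability Y R)
    (K : 'I_n -> X * Y -> R) : Prop :=
  {ae P, forall x k, {ae Q, forall y, (0 < K k (x, y))%R}}.

End dual_coupling.

Section scaling_step_dual.
Context {d1 d2} {X : measurableType d1} {Y : measurableType d2} {R : realType}.
Context {n : nat}.
Variables (P : probability X R) (Q : probability Y R) (eps : R).
Variables (f1 : X -> 'rV[R]_n -> \bar R) (f2 : Y -> 'rV[R]_n -> \bar R).
Variable K : 'I_n -> X * Y -> R.
Hypothesis eps0 : 0 < eps.
Hypothesis mK : forall k, measurable_fun setT (K k).
Hypothesis K_pos : positive_kernel P Q K.
Hypothesis Kt_pos : positive_kernel Q P (kernel_tr K).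
Hypothesis f1_adm : admissible P f1.
Hypothesis f1_pos : forall x, exists t : 'rV[R]_n,
  (forall k, 0 < t 0 k) /\ (f1 x t < +oo)%E.

Local Open Scope ereal_scope.

(** One half-step. The conclusion is the coupling with the two spaces exchanged, so the lemma can be
    applied to the other half-step in turn. *)
Lemma scaling_step_dual a b v : dual_coupled P Q eps f1 f2 K b v ->
  scaling_step P Q eps f1 K b a ->
  (exists u, dual_argmax P Q eps f1 K v u) /\
  forall u, dual_argmax P Q eps f1 K v u ->
    [/\ forall u', dual_argmax P Q eps f1 K v u' ->
          {ae P, forall x, u' x = u x},
        {ae P, forall x, a x = exp_vec eps u x} &
        dual_coupled Q P eps f2 f1 (kernel_tr K) a u].
Proof.
move=> [mb mv bv cv [u0 u0_feas]] [ma [z [s [mz zE s_prox aE]]]].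
pose kz := kernel_op Q K (exp_vec eps v).
have mev := measurable_exp_vec eps mv.
have mkz k : measurable_fun setT (kz k) by exact: measurable_kernel_op.
have kz_abs : {ae P, forall x k, kz k x = abs_kernel_op Q eps K v k x}.
  by apply: filterS K_pos => x Kx k; exact: kernel_op_abs.
have z_kz : {ae P, forall x k, (z x 0%R k)%:E = kz k x}.
  apply: filterS zE => x /= zx k; rewrite zx.
  exact: ae_eq_kernel_op.
have z_pos : {ae P, forall x k, (0 < z x 0 k)%R}.
  apply: filterS3 z_kz kz_abs K_pos => x zx kx Kx k.
  by rewrite -lte_fin zx kx; exact: abs_kernel_op_gt0.
(* The pointwise theory needs a marginal positive everywhere; [z] is so only almost everywhere, and
   the value 1 repairs the null set. *)
pose z' x : 'rV[R]_n := (\row_k (if 0 < z x 0 k then z x 0 k else 1))%R.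
have mz' : measurable_vec z'.
  move=> k; apply: (eq_measurable_fun
      (fun x => if 0 < z x 0 k then z x 0 k else 1))%R => [x _|].
    by rewrite mxE.
  by apply: measurable_fun_ifT => //; exact: measurable_fun_ltr.
have z'_gt0 x k : (0 < z' x 0 k)%R by rewrite mxE; case: ifPn.
have zz' : {ae P, forall x, z x = z' x}.
  by apply: filterS z_pos => x zx; apply/rowP => k; rewrite mxE zx.
pose z'E k x := (z' x 0%R k)%:E.
have mz'E k : measurable_fun setT (z'E k) by exact/measurable_EFinP.
have kz_z' : {ae P, forall x k, kz k x = z'E k x}.
  by apply: filterS2 z_kz zz' => x zx zz'x k; rewrite -zx /z'E -zz'x.
have [m [mm m_prox]] := prox_selection_exists eps0 f1_adm f1_pos mz' z'_gt0.
have [sm phi_fin] := proxKL_ae eps0 f1_adm f1_pos mz' z'_gt0 mm m_prox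
  (ae_eq_proxKL mz mz' zz' s_prox).
have u0_feas' : dual_feasible P eps f1 z'E u0.
  exact: ae_eq_dual_feasible u0_feas.
have [w_max w_uniq] := dual_fun_argmax eps0 f1_adm f1_pos mz' z'_gt0 mm m_prox
  phi_fin u0_feas'.
have argmaxE : dual_argmax P Q eps f1 K v =
    argmax measurable_vec (dual_fun P eps f1 z'E).
  by apply: eq_argmax => u mu_; exact: ae_eq_dual_fun.
rewrite argmaxE; split; first by eexists; exact: w_max.
move=> u u_max; have uw := w_uniq _ u_max; have [mu_ uNy _] := u_max.
have u_feas : dual_feasible P eps f1 z'E u.
  by apply: dual_fun_feasible => // k x; rewrite lee_fin ltW.
have au : {ae P, forall x, a x = exp_vec eps u x}.
  have sz : {ae P, forall x, s x = m x /\ z x = z' x}.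
    by apply: filterS2 sm zz' => x.
  apply: filterS3 sz aE uw => x [sx zx] ax ux; apply/rowP => k.
  rewrite ax mxE ux sx zx.
  have [_ [f1_convex [f1_ge0 [f1_dom _]]]] := f1_adm.
  rewrite -(expR_prox_dual eps0 (f1_convex x) (f1_ge0 x) (f1_dom x) (f1_pos x)
    (z'_gt0 x) (m_prox x) k).
  by rewrite mulrC mulKf// lt0r_neq0.
split => // [u' /w_uniq u'w|].
  by apply: filterS2 u'w uw => x -> ->.
have [_ cu _] := u_feas.
(* The current [v] witnesses feasibility for the next half-step: its conjugate term is controlled by
   [cv], its pairing is that of [u] after exchanging the integrals. *)
split => //; exists v; split => // k.
have mKt k' : measurable_fun setT (kernel_tr K k').
  by apply: (measurableT_comp (mK k')); exact: measurable_swap.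
have meu := measurable_exp_vec eps mu_.
rewrite (@ae_eq_exp_integral _ _ _ _ Q eps _
  (abs_kernel_op P eps (kernel_tr K) u))//.
- rewrite -abs_kernel_op_swap//.
  have [_ _ /(_ k)] := u_feas; apply: le_lt_trans.
  rewrite (@ae_eq_exp_integral _ _ _ _ P eps _ z'E)//.
  + exact: measurable_abs_kernel_op.
  + by apply: filterS2 kz_abs kz_z' => x <-.
- exact: measurable_kernel_op.
- exact: measurable_abs_kernel_op.
- by apply: filterS Kt_pos => y Ky; exact: kernel_op_abs.
Qed.

End scaling_step_dual.

(** * Properties of the kernel and the starting point *)

Section initialization.
Context {d1 d2} {X : measurableType d1} {Y : measurableType d2} {R : realType}.
Variables (P : probability X R) (Q : probability Y R).
Local Open Scope ereal_scope.

Lemma ge0_integral_eq0_ae d (T : measurableType d)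
    (mu : {measure set T -> \bar R}) (g : T -> \bar R) :
  measurable_fun setT g -> (forall x, 0 <= g x) -> \int[mu]_x g x = 0 ->
  {ae mu, forall x, g x = 0}.
Proof.
move=> mg g0 ig; have := (ae_eq_integral_abs mu measurableT mg).1.
under eq_integral do rewrite gee0_abs//.
by move=> /(_ ig); apply: filterS => x /(_ I).
Qed.

(** The indicator of the bad set has zero integral on the product; Tonelli in each order makes
    almost every slice of it null. *)
Lemma ae_product_gt0 (g : X * Y -> R) : measurable_fun setT g ->
  {ae P \x Q, forall p, (0 < g p)%R} ->
  {ae P, forall x, {ae Q, forall y, (0 < g (x, y))%R}} /\
  {ae Q, forall y, {ae P, forall x, (0 < g (x, y))%R}}.
Proof.
move=> mg g_gt0; pose B := [set p | (g p <= 0)%R].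
have mB : measurable B.
  rewrite /B -preimage_itvNyc -[X in measurable X]setTI.
  by apply: mg => //; exact: measurable_itv.
pose h p : \bar R := (\1_B p)%:E.
have mh : measurable_fun setT h.
  by apply/measurable_EFinP; exact: measurable_indic.
have h0 p : 0 <= h p by rewrite lee_fin.
have hB p : h p = 0 -> (0 < g p)%R.
  move=> /eqP; rewrite /h eqe indicE pnatr_eq0 eqb0 notin_setE /B/= => /negP.
  by rewrite -ltNge.
have ih : \int[P \x Q]_p h p = 0.
  rewrite integral_indic// setIT; have [N [mN N0 BN]] := g_gt0.
  apply: (subset_measure0 _ _ _ N0) => // p Bp; apply: BN => /=.
  by apply/negP; rewrite -leNgt.
split.
  have := ih; rewrite (fubini_tonelli1 h)// => /ge0_integral_eq0_ae.
  move=> /(_ (measurable_fun_fubini_tonelli_F h mh h0)).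
  move=> /(_ (fun x => integral_ge0 _ (fun y _ => h0 (x, y)))).
  apply: filterS => x /ge0_integral_eq0_ae.
  move=> /(_ (measurableT_comp mh (measurable_pair1 x))).
  move=> /(_ (fun y => h0 (x, y))).
  by apply: filterS => y; exact: hB.
have := ih; rewrite (fubini_tonelli2 h)// => /ge0_integral_eq0_ae.
move=> /(_ (measurable_fun_fubini_tonelli_G h mh h0)).
move=> /(_ (fun y => integral_ge0 _ (fun x _ => h0 (x, y)))).
apply: filterS => y /ge0_integral_eq0_ae.
move=> /(_ (measurableT_comp mh (measurable_pair2 y))).
move=> /(_ (fun x => h0 (x, y))).
by apply: filterS => x; exact: hB.
Qed.

Lemma conjugate0_le0 n (g : 'rV[R]_n -> \bar R) :
  (forall t, 0 <= g t) -> conjugate g (- 0)%R <= 0.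
Proof.
move=> g0; apply: ub_ereal_sup => _ [t _ <-].
rewrite big1 => [|k _]; last by rewrite !mxE oppr0 mul0r.
by rewrite add0e leeNl oppe0.
Qed.

Lemma conjugate0_feasible d (T : measurableType d) n
    (mu : {measure set T -> \bar R}) (f : T -> 'rV[R]_n -> \bar R) :
  (forall x t, 0 <= f x t) ->
  \int[mu]_x ((fun x => conjugate (f x) (- cst 0 x)%R)^\+ x) < +oo.
Proof.
move=> f0; rewrite (eq_integral (cst 0)) ?integral0 ?ltry// => x _.
by rewrite funeposE; apply/max_idPr; exact: conjugate0_le0.
Qed.

Variables (n : nat) (eps : R) (K : 'I_n -> X * Y -> R).
Hypothesis K_Linfty : forall k, K k \in Lfun (P \x Q) +oo.
Hypothesis K_pos : forall k, {ae P \x Q, forall p, (0 < K k p)%R}.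

Lemma Linfty_kernel_integrable k : (P \x Q).-integrable setT (EFin \o K k).
Proof.
have PQ_fin : (P \x Q) (setT `*` setT) \is a fin_num.
  by rewrite product_measure1E// fin_numM// fin_num_measure.
rewrite setXTT in PQ_fin.
apply/Lfun1_integrable; apply: (@Lfun_subset _ _ _ _ 1 +oo) => //;
  exact: leey.
Qed.

Lemma measurable_Linfty_kernel k : measurable_fun setT (K k).
Proof.
apply/measurable_EFinP; exact: measurable_int (Linfty_kernel_integrable k).
Qed.

Lemma positive_kernel_ae : positive_kernel P Q K.
Proof.
apply: filter_forall => k.
exact: (ae_product_gt0 (measurable_Linfty_kernel k) (K_pos k)).1.
Qed.

Lemma positive_kernel_tr_ae : positive_kernel Q P (kernel_tr K).
Proof.
apply: filter_forall => k.
exact: (ae_product_gt0 (measurable_Linfty_kernel k) (K_pos k)).2.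
Qed.

(** The function 0 is feasible on both sides: conjugates of nonnegative functions are nonpositive at
    0, and its pairing is the integral of the absolute value of the kernel, finite on a probability
    space. *)
Lemma dual_coupled0 (f1 : X -> 'rV[R]_n -> \bar R)
    (f2 : Y -> 'rV[R]_n -> \bar R) :
  (forall x t, 0 <= f1 x t) -> (forall y t, 0 <= f2 y t) ->
  dual_coupled P Q eps f1 f2 K (cst (const_mx 1%R)) (cst 0%R).
Proof.
move=> f1_ge0 f2_ge0.
have m0 d (T : measurableType d) (c : 'rV[R]_n) :
    measurable_vec (fun _ : T => c).
  by move=> k; exact: measurable_cst.
have exp0 T x k : exp_vec eps (fun _ : T => 0%R : 'rV[R]_n) x 0%R k = 1%R.
  by rewrite !mxE mul0r expR0.
split => //; first by apply: nearW => y; apply/rowP => k; rewrite exp0 mxE.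
  exact: conjugate0_feasible.
exists (cst 0%R); split => //; first exact: conjugate0_feasible.
move=> k; have mK := measurable_Linfty_kernel.
rewrite (@ae_eq_exp_integral _ _ _ _ P eps _
  (abs_kernel_op Q eps K (cst 0%R)))//.
- have /integrableP[_] := Linfty_kernel_integrable k.
  rewrite fubini_tonelli1//; last first.
    by apply: measurableT_comp => //; apply/measurable_EFinP; exact: mK.
  congr (_ < _); apply: eq_integral => x _; rewrite exp0 mul1e.
  by apply: eq_integral => y _; rewrite exp0 mulr1.
- by apply: measurable_kernel_op => //; exact: measurable_exp_vec.
- exact: measurable_abs_kernel_op.
- apply: filterS positive_kernel_ae => x Kx; exact: kernel_op_abs.
Qed.

End initialization.

(** * Construction and identification of the dual iterates *)

Theorem theorem3p8 (R : realType) (d1 d2 : measure_display)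
    (X : measurableType d1) (Y : measurableType d2)
    (P : probability X R) (Q : probability Y R)
    (n : nat) (hn : (0 < n)%N) (eps : R) (heps : 0 < eps)
    (K : 'I_n -> X * Y -> R)
    (K_Linfty : forall k, K k \in Lfun (P \x Q)%E +oo%E)
    (K_pos : forall k, {ae (P \x Q)%E, forall p, 0 < K k p})
    (f1 : X -> 'rV[R]_n -> \bar R) (f2 : Y -> 'rV[R]_n -> \bar R)
    (f1_adm : admissible P f1) (f2_adm : admissible Q f2)
    (f1_pos : forall x, exists s1 : 'rV[R]_n,
       (forall k, 0 < s1 0 k) /\ (f1 x s1 < +oo)%E)
    (f2_pos : forall y, exists s2 : 'rV[R]_n,
       (forall k, 0 < s2 0 k) /\ (f2 y s2 < +oo)%E)
    (a : nat -> X -> 'rV[R]_n) (b : nat -> Y -> 'rV[R]_n)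
    (hab : scaling_iterates P Q eps f1 f2 K a b) :
  (exists u v, dual_iterates P Q eps f1 f2 K u v) /\
  (forall u v, dual_iterates P Q eps f1 f2 K u v -> forall l : nat,
     [/\ forall u', dual_argmax P Q eps f1 K (v l) u' ->
           {ae P, forall x, u' x = u l.+1 x},
         forall v', dual_argmax Q P eps f2 (kernel_tr K) (u l.+1) v' ->
           {ae Q, forall y, v' y = v l.+1 y},
         {ae P, forall x, a l.+1 x = exp_vec eps (u l.+1) x} &
         {ae Q, forall y, b l y = exp_vec eps (v l) y} ]).
Proof.
have mK := measurable_Linfty_kernel K_Linfty.
have mKt k : measurable_fun setT (kernel_tr K k).
  by apply: (measurableT_comp (mK k)); exact: measurable_swap.
have KP := positive_kernel_ae K_Linfty K_pos.
have KtP := positive_kernel_tr_ae K_Linfty K_pos.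
(* Transposition is an involution, so the half-step on [Y] hands back a coupling for [K] itself. *)
have KttE : kernel_tr (kernel_tr K) = K.
  by apply/funext => k; apply/funext => -[x y].
have f1_ge0 : forall x t, (0 <= f1 x t)%E by case: f1_adm => _ [_ []].
have f2_ge0 : forall y t, (0 <= f2 y t)%E by case: f2_adm => _ [_ []].
have [b0 step] := hab.
pose coupled l v := dual_coupled P Q eps f1 f2 K (b l) v.
have coupled0 : coupled 0%N (cst 0).
  by rewrite /coupled b0; exact: dual_coupled0.
have stepX l v : coupled l v -> _ := fun vl =>
  scaling_step_dual heps mK KP KtP f1_adm f1_pos vl (step l).1.
have KttP : positive_kernel P Q (kernel_tr (kernel_tr K)) by rewrite KttE.
have stepY l u : dual_coupled Q P eps f2 f1 (kernel_tr K) (a l.+1) u -> _ :=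
  fun ul => scaling_step_dual heps mKt KtP KttP f2_adm f2_pos ul (step l).2.
rewrite KttE in stepY.
split.
  (* One full iteration as a total function of the index and of [v], with a default value off the
     coupled pairs; iterating it realizes the dependent choices. *)
  have /choice[F FP] (lv : nat * (Y -> 'rV[R]_n)) :
      exists uv : (X -> 'rV[R]_n) * (Y -> 'rV[R]_n), coupled lv.1 lv.2 ->
      [/\ dual_argmax P Q eps f1 K lv.2 uv.1,
          dual_argmax Q P eps f2 (kernel_tr K) uv.1 uv.2 &
          coupled lv.1.+1 uv.2].
    case: lv => l v /=; have [vl|nvl] := pselect (coupled l v); last first.
      by exists (cst 0, cst 0).
    have [[u u_max] /(_ u u_max)[_ _ ul]] := stepX _ _ vl.
    have [[v' v'_max] /(_ v' v'_max)[_ _ v'l]] := stepY _ _ ul.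
    by exists (u, v') => _; split; [exact: u_max|exact: v'_max|exact: v'l].
  pose v := fix v l := if l is l'.+1 then (F (l', v l')).2 else cst 0.
  (* The shift reflects that [u l.+1] is computed from [v l]. *)
  pose u l := (F (l.-1, v l.-1)).1.
  have vl l : coupled l (v l).
    elim: l => [|l vl]; first exact: coupled0.
    by have [_ _ vSl] := FP (l, v l) vl; exact: vSl.
  exists u, v; split; first exact: erefl.
  move=> l; have [u_max v_max _] := FP (l, v l) (vl l).
  by split; [exact: u_max|exact: v_max].
move=> u v [v0 uv].
(* The coupling holds along arbitrary dual iterates, since [scaling_step_dual] transfers it through
   every maximizer. *)
have vl l : coupled l (v l).
  elim: l => [|l vl]; first by rewrite v0; exact: coupled0.
  have [u_max v_max] := uv l.
  have [_ /(_ _ u_max)[_ _ ul]] := stepX _ _ vl.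
  by have [_ /(_ _ v_max)[_ _ vSl]] := stepY _ _ ul; exact: vSl.
move=> l; have [u_max v_max] := uv l.
have [_ /(_ _ u_max)[u_uniq au ul]] := stepX _ _ (vl l).
have [_ /(_ _ v_max)[v_uniq _ _]] := stepY _ _ ul.
have [_ _ bv _ _] := vl l.
by split; [exact: u_uniq|exact: v_uniq|exact: au|exact: bv].
Qed.
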